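(* Let $S,\mathcal Z,h^{\mathcal Z},R$, $g_R=R^*h^{\mathcal Z}$, $g^S$, $\nabla^S$ and the response Gram operator $G_R$ be as in the context. Let $p(t)$ be a smooth path in $S$, write $G_R(t)$ for $G_R$ at $p(t)$ and $\frac{D}{dt}G_R$ for its covariant derivative along the path with respect to $\nabla^S$. (a) Suppose that $\mu_i(t)>0$ is a simple eigenvalue of $G_R(t)$ with $g^S$-unit eigenvector $u_i(t)$, and set $\sigma_i(t)=\sqrt{\mu_i(t)}$. Then $$\dot\mu_i=g^S\!\left(\tfrac{D}{dt}G_R\,u_i,u_i\right)\qquad\text{and}\qquad \dot\sigma_i=\frac1{2\sigma_i}\,g^S\!\left(\tfrac{D}{dt}G_R\,u_i,u_i\right).$$ (b) If $\dim S>0$ and the path lies in the complete-response locus $S_{\mathrm{comp}}=\{p\in S:\ker R_p=\{0\}\}$, then $$\frac{d}{dt}\log\det G_R=\operatorname{tr}\!\left(G_R^{-1}\tfrac{D}{dt}G_R\right).$$ (c) If $\dim S>0$, the path lies in $S_{\mathrm{comp}}$, and the largest and smallest singular values $\sigma_{\max},\sigma_{\min}$ of $R$ along the path are simple, then $$\frac{d}{dt}\log\kappa_R=\frac{\dot\sigma_{\max}}{\sigma_{\max}}-\frac{\dot\sigma_{\min}}{\sigma_{\min}}.$$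
   Context: $S$ is a smooth finite-dimensional manifold parameterizing a smooth family $\{g_p\}_{p\in S}$ of normalized Einstein metrics on a fixed smooth manifold $M$. The family comes with the following given data, which is all that the statement uses: a smooth real vector bundle $\mathcal Z\to S$ of finite rank, a smooth positive-definite fibre metric $h^{\mathcal Z}$ on $\mathcal Z$, and a smooth vector bundle morphism $R:TS\to\mathcal Z$ over the identity of $S$. The response metric is $g_R(X,Y)=h^{\mathcal Z}(RX,RY)$. Fix an auxiliary Riemannian metric $g^S$ on $S$ with Levi-Civita connection $\nabla^S$. The response Gram operator $G_R$ is the bundle endomorphism of $TS$ with $g^S(G_RX,Y)=g_R(X,Y)$; it is smooth, $g^S$-self-adjoint and positive semidefinite. The singular values of $R$ (with respect to $g^S$ and $h^{\mathcal Z}$) are the square roots $\sigma_i$ of the eigenvalues $\mu_i$ of $G_R$; $\sigma_{\max}$ and $\sigma_{\min}$ denote the largest and smallest, and $\kappa_R=\sigma_{\max}/\sigma_{\min}$ is the condition number. ''Simple'' means that the corresponding eigenvalue of $G_R$ has multiplicity one. *)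

(* Defs.v *)
From HB Require Import structures.
From mathcomp Require Import all_boot all_order all_algebra.
From mathcomp Require Import all_classical all_reals all_analysis.

Set Implicit Arguments.
Unset Strict Implicit.
Unset Printing Implicit Defensive.
Import Order.TTheory GRing.Theory Num.Theory.
Import numFieldNormedType.Exports.
Local Open Scope classical_set_scope.
Local Open Scope ring_scope.

(* Meant for [U] open; [f] is total but only its germs at points of [U] matter.
   The spaces are finite dimensional below, so that "all the directional
   derivatives are C^k" says that the differential is C^k. *)
Fixpoint Ck_on (R : realType) (V W : normedModType R) (k : nat)
    (U : set V) (f : V -> W) : Prop :=
  if k is k'.+1 then
    (forall x, U x -> differentiable f x) /\
    (forall v, Ck_on k' U ('D_v f))
  else forall x, U x -> {for x, continuous f}.

Definition smooth_on (R : realType) (V W : normedModType R)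
    (U : set V) (f : V -> W) : Prop :=
  forall k, Ck_on k U f.

(* A smooth n-manifold given by an atlas.  [phi c] is a chart with domain
   [dom c] and inverse [psi c]; outside [dom c] and [phi c @` dom c] the values
   of these functions are irrelevant.  [chart_at p] is a preferred chart around
   [p], used to represent the tangent space at [p]. *)
Record manifold (R : realType) (n : nat) := Manifold {
  carrier :> topologicalType;
  carrier_hausdorff : hausdorff_space carrier;
  carrier_second_countable : @second_countable carrier;
  chart : Type;
  dom : chart -> set carrier;
  phi : chart -> carrier -> 'rV[R]_n;
  psi : chart -> 'rV[R]_n -> carrier;
  chart_at : carrier -> chart;
  chart_atP : forall p, dom (chart_at p) p;
  dom_open : forall c, open (dom c);
  phi_open : forall c, open (phi c @` dom c);
  phiK : forall c p, dom c p -> psi c (phi c p) = p;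
  phi_continuous : forall c p, dom c p -> {for p, continuous (phi c)};
  psi_continuous : forall c x, (phi c @` dom c) x -> {for x, continuous (psi c)};
  transition_smooth : forall c d,
    smooth_on (phi c @` (dom c `&` dom d)) (phi d \o psi c)
}.

Arguments dom {R n m} c.
Arguments phi {R n m} c.
Arguments psi {R n m} c.
Arguments chart_at {R n m} p.

Section Manifold.
Variables (R : realType) (n : nat) (S : manifold R n).

Definition smooth_map (W : normedModType R) (U : set S) (f : S -> W) : Prop :=
  forall c : chart S, smooth_on (phi c @` (dom c `&` U)) (f \o psi c).

(* T_p S, represented by the components of vectors in the chart [chart_at p].
   Endomorphisms of T_p S are n x n matrices acting on the right of row
   vectors. *)
Definition tangent (p : S) := 'rV[R]_n.

Definition vector_field := forall p : S, tangent p.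

(* Components of the tangent vector v in an arbitrary chart c around p. *)
Definition tangent_coord (c : chart S) (p : S) (v : tangent p) : 'rV[R]_n :=
  'D_v (phi c \o psi (chart_at p)) (phi (chart_at p) p).

(* The derivative v(f) of a function f at p. *)
Definition vec_der (p : S) (v : tangent p) (f : S -> R) : R :=
  'D_v (f \o psi (chart_at p)) (phi (chart_at p) p).

(* Fibres together with local trivialisations [tcoord a], over the sets
   [tdom a]. *)
Record bundle_data (k : nat) := BundleData {
  fibre : S -> lmodType R;
  triv : Type;
  tdom : triv -> set S;
  tcoord : triv -> forall p, fibre p -> 'rV[R]_k
}.

(* The topology and the smooth structure of the total space are the ones
   determined by the trivialisations. *)
Record is_vector_bundle (k : nat) (E : bundle_data k) : Prop := IsVectorBundle {
  tdom_open : forall a : triv E, open (tdom a);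
  tdom_cover : forall p, exists a : triv E, tdom a p;
  tcoord_linear : forall (a : triv E) p, tdom a p -> linear (tcoord a (p := p));
  tcoord_bij : forall (a : triv E) p, tdom a p -> bijective (tcoord a (p := p));
  tcoord_transition : forall a b : triv E, exists A : S -> 'M[R]_k,
    smooth_map (tdom a `&` tdom b) A /\
    forall p (v : fibre E p), (tdom a `&` tdom b) p ->
      tcoord b v = tcoord a v *m A p
}.

Definition tangent_bundle : bundle_data n :=
  @BundleData n (fun p => 'rV[R]_n : lmodType R) (chart S) (@dom R n S)
    tangent_coord.

Definition smooth_section (k : nat) (E : bundle_data k) (U : set S)
    (s : forall p, fibre E p) : Prop :=
  forall a : triv E, smooth_map (tdom a `&` U) (fun p => tcoord a (s p)).

Definition smooth_vector_field (U : set S) (X : vector_field) : Prop :=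
  smooth_section (E := tangent_bundle) U X.

Definition inner_product (V : lmodType R) (b : V -> V -> R) : Prop :=
  [/\ forall a u v w, b (a *: u + v) w = a * b u w + b v w,
      forall u v, b u v = b v u
    & forall u, u != 0 -> 0 < b u u].

Record is_fibre_metric (k : nat) (E : bundle_data k)
    (h : forall p, fibre E p -> fibre E p -> R) : Prop := IsFibreMetric {
  fibre_metric_inner : forall p, inner_product (@h p);
  fibre_metric_smooth : forall (U : set S) (s s' : forall p, fibre E p),
    open U -> smooth_section U s -> smooth_section U s' ->
    smooth_map U (fun p => h p (s p) (s' p))
}.

Definition is_riemannian_metric (g : forall p : S, tangent p -> tangent p -> R) :=
  is_fibre_metric (E := tangent_bundle) g.

(* A smooth bundle morphism from TS to E over the identity of S. *)
Record is_tangent_morphism (k : nat) (E : bundle_data k)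
    (F : forall p : S, tangent p -> fibre E p) : Prop := IsTangentMorphism {
  morphism_linear : forall p, linear (@F p : 'rV[R]_n -> fibre E p);
  morphism_smooth : forall (U : set S) (X : vector_field),
    open U -> smooth_vector_field U X -> smooth_section U (fun p => F p (X p))
}.

(* [nabla p v Y] is the covariant derivative at p, in the direction v, of a
   vector field Y which is smooth near p.  Since vector fields and functions are
   total but only assumed smooth on an open set, the Leibniz rule (applied to
   indicator functions) makes [nabla p v Y] depend on the germ of Y only. *)
Definition connection_op :=
  forall p : S, tangent p -> vector_field -> tangent p.

Record is_connection (nabla : connection_op) : Prop := IsConnection {
  connection_linear : forall (U : set S) (Y : vector_field) p a (v w : tangent p),
    open U -> smooth_vector_field U Y -> U p ->
    nabla p (a *: v + w) Y = a *: nabla p v Y + nabla p w Y;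
  connection_add : forall (U : set S) (Y Z : vector_field) p (v : tangent p),
    open U -> smooth_vector_field U Y -> smooth_vector_field U Z -> U p ->
    nabla p v (fun q => Y q + Z q) = nabla p v Y + nabla p v Z;
  connection_leibniz : forall (U : set S) (f : S -> R) (Y : vector_field) p
      (v : tangent p),
    open U -> smooth_map U f -> smooth_vector_field U Y -> U p ->
    nabla p v (fun q => f q *: Y q) = vec_der v f *: Y p + f p *: nabla p v Y;
  connection_smooth : forall (U : set S) (X Y : vector_field),
    open U -> smooth_vector_field U X -> smooth_vector_field U Y ->
    smooth_vector_field U (fun p => nabla p (X p) Y)
}.

(* The bracket [X, Y] is expressed by its action X(Y f) - Y(X f) on functions. *)
Definition torsion_free (nabla : connection_op) : Prop :=
  forall (U : set S) (X Y : vector_field) (f : S -> R) p,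
    open U -> smooth_vector_field U X -> smooth_vector_field U Y ->
    smooth_map U f -> U p ->
    vec_der (p := p) (nabla p (X p) Y - nabla p (Y p) X) f =
    vec_der (X p) (fun q => vec_der (Y q) f) -
    vec_der (Y p) (fun q => vec_der (X q) f).

Definition metric_compatible (g : forall p : S, tangent p -> tangent p -> R)
    (nabla : connection_op) : Prop :=
  forall (U : set S) (Y Z : vector_field) p (v : tangent p),
    open U -> smooth_vector_field U Y -> smooth_vector_field U Z -> U p ->
    vec_der v (fun q => g q (Y q) (Z q)) =
    g p (nabla p v Y) (Z p) + g p (Y p) (nabla p v Z).

Definition is_levi_civita (g : forall p : S, tangent p -> tangent p -> R)
    (nabla : connection_op) : Prop :=
  [/\ is_connection nabla, torsion_free nabla & metric_compatible g nabla].

Definition smooth_path (J : set R) (p : R -> S) : Prop :=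
  (forall t, J t -> {for t, continuous p}) /\
  (forall c : chart S, smooth_on (J `&` p @^-1` dom c) (phi c \o p)).

Definition velocity (p : R -> S) (t : R) : tangent (p t) :=
  'D_1 (phi (chart_at (p t)) \o p) t.

Definition field_along (p : R -> S) := forall t, tangent (p t).

Definition smooth_along (p : R -> S) (K : set R) (V : field_along p) : Prop :=
  forall c : chart S,
    smooth_on (K `&` p @^-1` dom c) (fun t => tangent_coord c (V t)).

(* The characteristic properties of the covariant derivative D/dt of vector
   fields along p : J -> S; they determine D V t for V smooth near t. *)
Record is_covariant_derivative_along (nabla : connection_op) (J : set R)
    (p : R -> S) (D : field_along p -> field_along p) : Prop :=
  IsCovariantDerivativeAlong {
  along_add : forall (K : set R) (V W : field_along p) t,
    open K -> K `<=` J -> smooth_along K V -> smooth_along K W -> K t ->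
    D (fun s => V s + W s) t = D V t + D W t;
  along_leibniz : forall (K : set R) (f : R -> R) (V : field_along p) t,
    open K -> K `<=` J -> smooth_on K f -> smooth_along K V -> K t ->
    D (fun s => f s *: V s) t = 'D_1 f t *: V t + f t *: D V t;
  along_extension : forall (U : set S) (Y : vector_field) t,
    open U -> smooth_vector_field U Y -> J t -> U (p t) ->
    D (fun s => Y (p s)) t = nabla (p t) (velocity p t) Y
}.

(* The induced covariant derivative of a field A of endomorphisms along p:
   (DA) V = D (A V) - A (D V). *)
Definition is_covariant_derivative_end (J : set R) (p : R -> S)
    (D : field_along p -> field_along p) (A DA : R -> 'M[R]_n) : Prop :=
  forall (K : set R) (V : field_along p) t,
    open K -> K `<=` J -> smooth_along K V -> K t ->
    V t *m DA t = D (fun s => V s *m A s) t - D V t *m A t.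

Definition response_metric (k : nat) (Z : bundle_data k)
    (h : forall p, fibre Z p -> fibre Z p -> R)
    (F : forall p : S, tangent p -> fibre Z p) (p : S) (X Y : tangent p) : R :=
  h p (F p X) (F p Y).

Definition is_gram_operator (g gR : forall p : S, tangent p -> tangent p -> R)
    (G : S -> 'M[R]_n) : Prop :=
  forall p (X Y : tangent p), g p (X *m G p) Y = gR p X Y.

Definition complete_locus (k : nat) (Z : bundle_data k)
    (F : forall p : S, tangent p -> fibre Z p) : set S :=
  [set p | forall v : tangent p, F p v = 0 -> v = 0].

End Manifold.

Section Spectrum.
Variables (R : realType) (n : nat).

(* m lists the eigenvalues of A in nonincreasing order, with multiplicity. *)
Definition ordered_eigenvalues (A : 'M[R]_n) (m : 'I_n -> R) : Prop :=
  (forall i j : 'I_n, (i <= j)%N -> m j <= m i) /\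
  char_poly A = \prod_(i < n) ('X - (m i)%:P).

Definition simple_eigenvalue (A : 'M[R]_n) (a : R) : Prop :=
  mup a (char_poly A) = 1%N.

Definition singular_values (A : 'M[R]_n) : set R :=
  [set Num.sqrt a | a in [set a | eigenvalue A a]].

(* The supremum and infimum are attained: the set is finite, and it is nonempty
   when n > 0 and A is a Gram operator. *)
Definition sigma_max (A : 'M[R]_n) : R := sup (singular_values A).
Definition sigma_min (A : 'M[R]_n) : R := inf (singular_values A).

Definition simple_singular_value (A : 'M[R]_n) (s : R) : Prop :=
  singular_values A s /\ simple_eigenvalue A (s ^+ 2).

Definition condition_number (A : 'M[R]_n) : R := sigma_max A / sigma_min A.

End Spectrum.

(* Main.v *)
(** In a coordinate frame the Gram operator along the path becomes a smooth
matrix function A, similar to G_R and equal to H (g_ij)^-1, where H is the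
matrix of the response metric; in this frame D/dt G_R is A' plus a commutator
of A with the connection matrix. The commutator is invisible to tr(A^-1 _) and
to u _ w when u and w are left and right eigenvectors for the same eigenvalue,
so only matrix calculus remains.

The ordered eigenvalues mu_j are continuous: every cluster point of the
(locally bounded) list of roots is the ordered list of roots of the limit
polynomial. For a simple eigenvalue l = mu_i(t), the quotient
  l - mu_i(s) = det (l - A(s)) / prod_(j != i) (l - mu_j(s))
has a differentiable numerator vanishing at t and a continuous nonvanishing
denominator, so mu_i is differentiable at t. By Jacobi's formula and
adj (l - A(t)) = prod_(j != i) (l - mu_j(t)) w u, where u and w are left and
right eigenvectors with u w = 1, its derivative is u A' w; finally w is the
g-dual of u because A is self-adjoint. *)

Require Import Defs.
From HB Require Import structures.
From mathcomp Require Import all_boot all_order all_algebra.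
From mathcomp Require Import perm complex.
From mathcomp Require Import all_classical all_reals all_analysis.

Set Implicit Arguments.
Unset Strict Implicit.
Unset Printing Implicit Defensive.
Import Order.TTheory GRing.Theory Num.Theory.
Import numFieldNormedType.Exports.
Local Open Scope classical_set_scope.
Local Open Scope ring_scope.

(** * Functions of class C^k on open sets *)

Section SmoothCalculus.
Variable R : realType.
Implicit Types V W : normedModType R.

(** The first-order expansion of [f] at [x] only involves the germ of [f], so the differential of
    [f] also serves for [g]. *)
Lemma near_eq_differentiable V W (f g : V -> W) x :
  (\near x, f x = g x) -> differentiable f x -> differentiable g x.
Proof.
move=> fg df; have dfc := diff_continuous df.
have H : g \o shift x = cst (g x) + 'd f x +o_ 0 id.
  apply/eqaddoP => e e0; have /eqaddoP/(_ e e0) := diff_locally df.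
  have := fg; rewrite (near_shift 0)/= subr0; apply: filterS2 => h fgh.
  by rewrite !fctE /= -fgh -(nbhs_singleton fg).
by apply/diff_locallyP; rewrite (diff_unique dfc H).
Qed.

Lemma Ck_on_subset V W k (U U' : set V) (f : V -> W) :
  U' `<=` U -> Ck_on k U f -> Ck_on k U' f.
Proof.
move=> sU; elim: k f => [|k IH] f /=; first by move=> h x /sU; exact: h.
by case=> df h; split=> [x /sU/df//|v]; exact: IH.
Qed.

(** Functions are total, but the formulas for them hold only on [U]. Openness turns equality on [U]
    into equality of germs, which all iterated derivatives respect. *)
Lemma Ck_on_ext V W k (U : set V) (f g : V -> W) :
  open U -> (forall x, U x -> f x = g x) -> Ck_on k U f -> Ck_on k U g.
Proof.
move=> oU; have fgn (h1 h2 : V -> W) x : (forall y, U y -> h1 y = h2 y) ->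
    U x -> \near x, h1 x = h2 x.
  by move=> h12 Ux; near=> y; apply: h12; near: y; exact: open_nbhs_nbhs.
elim: k f g => [|k IH] f g fg /=.
  move=> cf x Ux; suff: g @ x --> g x by []; rewrite -(fg x Ux).
  by apply: cvg_trans (cf x Ux); exact: near_eq_cvg (fgn _ _ _ fg Ux).
move=> [df h]; split=> [x Ux|v].
  by apply: near_eq_differentiable (df x Ux); exact: fgn.
by apply: IH (h v) => x Ux; apply: near_eq_derive; exact: fgn.
Unshelve. all: by end_near. Qed.

Lemma Ck_on_pred V W k (U : set V) (f : V -> W) :
  Ck_on k.+1 U f -> Ck_on k U f.
Proof.
elim: k f => [|k IH] f [df h].
  by move=> x Ux; exact/differentiable_continuous/df.
by split=> // v; exact: IH.
Qed.

Lemma Ck_on_cst V W k (U : set V) (a : W) : Ck_on k U (cst a).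
Proof.
elim: k a => [|k IH] a; first by move=> x _; exact: cvg_cst.
split=> [x _|v]; first exact: differentiable_cst.
have -> : 'D_v (cst a) = cst (0 : W) by apply/funext => x; rewrite derive_cst.
exact: IH.
Qed.

Lemma Ck_onD V W k (U : set V) (f g : V -> W) : open U ->
  Ck_on k U f -> Ck_on k U g -> Ck_on k U (fun x => f x + g x).
Proof.
move=> oU; elim: k f g => [|k IH] f g.
  by move=> cf cg x Ux; apply: cvgD; [exact: cf|exact: cg].
move=> [df cf] [dg cg]; split=> [x Ux|v].
  by apply: differentiableD; [exact: df|exact: dg].
apply: (@Ck_on_ext _ _ k U (fun x => 'D_v f x + 'D_v g x)) => //.
  move=> x Ux; symmetry.
  by apply: deriveD; apply: diff_derivable; [exact: df|exact: dg].
exact: IH (cf v) (cg v).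
Qed.

Lemma Ck_on_sum V W k (U : set V) (I : Type) (r : seq I) (f : I -> V -> W) :
  open U -> (forall i, Ck_on k U (f i)) ->
  Ck_on k U (fun x => \sum_(i <- r) f i x).
Proof.
move=> oU cf; elim: r => [|i r IH].
  apply: (@Ck_on_ext _ _ k U (cst 0)) => //; first by move=> x _; rewrite big_nil.
  exact: Ck_on_cst.
apply: (@Ck_on_ext _ _ k U (fun x => f i x + \sum_(j <- r) f j x)) => //.
  by move=> x _; rewrite big_cons.
exact: Ck_onD.
Qed.

Lemma Ck_onM V k (U : set V) (f g : V -> R) : open U ->
  Ck_on k U f -> Ck_on k U g -> Ck_on k U (fun x => f x * g x).
Proof.
move=> oU; elim: k f g => [|k IH] f g.
  by move=> cf cg x Ux; apply: cvgM; [exact: cf|exact: cg].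
move=> cf' cg'; move: (cf') (cg') => [df cf] [dg cg]; split=> [x Ux|v].
  by apply: differentiableM; [exact: df|exact: dg].
apply: (@Ck_on_ext _ _ k U (fun x => f x * 'D_v g x + g x * 'D_v f x)) => //.
  move=> x Ux; symmetry.
  by apply: deriveM; apply: diff_derivable; [exact: df|exact: dg].
apply: Ck_onD => //; first exact: IH (Ck_on_pred cf') (cg v).
exact: IH (Ck_on_pred cg') (cf v).
Qed.

Lemma Ck_on_prod V k (U : set V) (I : Type) (r : seq I) (f : I -> V -> R) :
  open U -> (forall i, Ck_on k U (f i)) ->
  Ck_on k U (fun x => \prod_(i <- r) f i x).
Proof.
move=> oU cf; elim: r => [|i r IH].
  apply: (@Ck_on_ext _ _ k U (cst (1 : R)) _ oU); first by move=> x _; rewrite big_nil.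
  exact: Ck_on_cst.
apply: (@Ck_on_ext _ _ k U (fun x => f i x * \prod_(j <- r) f j x)) => //.
  by move=> x _; rewrite big_cons.
exact: Ck_onM.
Qed.

Lemma Ck_onV V k (U : set V) (f : V -> R) : open U ->
  (forall x, U x -> f x != 0) -> Ck_on k U f -> Ck_on k U (fun x => (f x)^-1).
Proof.
move=> oU f0; elim: k => [|k IH].
  by move=> cf x Ux; apply: cvgV; [exact: f0|exact: cf].
move=> cf'; move: (cf') => [df cf]; split=> [x Ux|v].
  by apply: differentiableV; [exact: df|exact: f0].
have cV := IH (Ck_on_pred cf').
apply: (@Ck_on_ext _ _ k U (fun x => -1 * ((f x)^-1 * (f x)^-1) * 'D_v f x)) => //.
  move=> x Ux; symmetry.
  rewrite deriveV; [|exact: f0|exact/diff_derivable/df].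
  by rewrite mulN1r -invfM -expr2.
apply: (Ck_onM oU _ (cf v)); apply: (Ck_onM oU); last exact: (Ck_onM oU).
exact: Ck_on_cst.
Qed.

Lemma derive_rV_coord V n (f : V -> 'rV[R]_n) x v j : derivable f x v ->
  'D_v (fun y => f y ord0 j) x = 'D_v f x ord0 j.
Proof. by move=> df; rewrite derive_mx// mxE. Qed.

Lemma Ck_on_coord V n k (U : set V) (f : V -> 'rV[R]_n) j : open U ->
  Ck_on k U f -> Ck_on k U (fun x => f x ord0 j).
Proof.
move=> oU; elim: k f => [|k IH] f.
  move=> cf x Ux.
  exact: (continuous_comp (cf x Ux) (@coord_continuous _ _ _ ord0 j _)).
move=> [df cf]; split=> [x Ux|v].
  exact: (differentiable_comp (df x Ux) (differentiable_coord _ ord0 j)).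
apply: (@Ck_on_ext _ _ k U (fun x => 'D_v f x ord0 j)) => //; last exact: IH (cf v).
by move=> x Ux; rewrite derive_rV_coord//; exact/diff_derivable/df.
Qed.

Lemma continuous_rV V n (f : V -> 'rV[R]_n) x :
  (forall j, {for x, continuous (fun y => f y ord0 j)}) -> {for x, continuous f}.
Proof.
move=> cf; rewrite /continuous_at; apply/cvgrPdist_le => /= e e0.
near=> y; rewrite /Num.Def.normr/= mx_normrE (bigmax_le _ (ltW e0))//= => -[i j] _.
rewrite !mxE/= ord1; move: j; near: y; apply: filter_forall => /= j.
by have /cvgrPdist_le/(_ e e0) := cf j.
Unshelve. all: by end_near. Qed.

Lemma differentiable_rV V n (f : V -> 'rV[R]_n) x :
  (forall j, differentiable (fun y => f y ord0 j) x) -> differentiable f x.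
Proof.
move=> df.
have -> : f = \sum_(j < n) (fun y => f y ord0 j *: delta_mx ord0 j).
  by apply/funext => y; rewrite fct_sumE -row_sum_delta.
by apply: differentiable_sum => j; exact: differentiableZl.
Qed.

Lemma Ck_on_rV V n k (U : set V) (f : V -> 'rV[R]_n) : open U ->
  (forall j, Ck_on k U (fun x => f x ord0 j)) -> Ck_on k U f.
Proof.
move=> oU; elim: k f => [|k IH] f cf.
  by move=> x Ux; apply: continuous_rV => j; exact: cf.
have df x : U x -> differentiable f x.
  by move=> Ux; apply: differentiable_rV => j; have [+ _] := cf j; exact.
split=> // v; apply: IH => j; have [_ /(_ v)] := cf j.
apply: Ck_on_ext => // x Ux.
by rewrite derive_rV_coord//; exact/diff_derivable/df.
Qed.

Lemma derive_comp V m W (f : V -> 'rV[R]_m) (g : 'rV[R]_m -> W) x v :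
  differentiable f x -> differentiable g (f x) ->
  'D_v (g \o f) x = 'D_('D_v f x) g (f x).
Proof.
move=> df dg; rewrite deriveE; last exact: differentiable_comp.
by rewrite diff_comp//= -!deriveE.
Qed.

Lemma derive_sum_coord m W (g : 'rV[R]_m -> W) x v : differentiable g x ->
  'D_v g x = \sum_(j < m) v ord0 j *: 'D_(delta_mx ord0 j) g x.
Proof.
move=> dg; rewrite deriveE// [in LHS](row_sum_delta v) linear_sum.
by apply: eq_bigr => j _; rewrite linearZ/= deriveE.
Qed.

(** The chain rule differentiates [g] in the direction ['D_v f x], which varies with [x], whereas
    [Ck_on] speaks of fixed directions. Expanding this direction in the standard basis leaves a sum
    of products to which induction applies. *)
Lemma Ck_on_comp_scalar V m k (U : set V) (O : set 'rV[R]_m)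
    (f : V -> 'rV[R]_m) (g : 'rV[R]_m -> R) :
  open U -> (forall x, U x -> O (f x)) ->
  Ck_on k U f -> Ck_on k O g -> Ck_on k U (g \o f).
Proof.
move=> oU UO; elim: k g => [|k IH] g.
  by move=> cf cg x Ux; apply: continuous_comp; [exact: cf|exact/cg/UO].
move=> cf' cg'; move: (cf') (cg') => [df cf] [dg cg]; split=> [x Ux|v].
  by apply: differentiable_comp; [exact: df|exact/dg/UO].
apply: (@Ck_on_ext _ _ k U (fun x => \sum_(j < m)
    'D_v f x ord0 j * ('D_(delta_mx ord0 j) g \o f) x)) => //.
  move=> x Ux; symmetry.
  by rewrite derive_comp ?derive_sum_coord//; [exact/dg/UO|exact: df|exact/dg/UO].
apply: Ck_on_sum => // j; apply: (Ck_onM oU); first exact: Ck_on_coord (cf v).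
exact: IH (Ck_on_pred cf') (cg _).
Qed.

Lemma Ck_on_comp V m n k (U : set V) (O : set 'rV[R]_m)
    (f : V -> 'rV[R]_m) (g : 'rV[R]_m -> 'rV[R]_n) :
  open U -> open O -> (forall x, U x -> O (f x)) ->
  Ck_on k U f -> Ck_on k O g -> Ck_on k U (g \o f).
Proof.
move=> oU oO UO cf cg; apply: Ck_on_rV => // j.
exact: (Ck_on_comp_scalar oU UO cf (Ck_on_coord j oO cg)).
Qed.

Lemma Ck_on_det V n k (U : set V) (A : V -> 'M[R]_n) : open U ->
  (forall i j, Ck_on k U (fun x => A x i j)) -> Ck_on k U (fun x => \det (A x)).
Proof.
move=> oU cA; apply: Ck_on_sum => // s; apply: Ck_onM => //.
  exact: Ck_on_cst.
by apply: Ck_on_prod => // i.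
Qed.

(** Cramer's rule: the entries of the inverse are cofactors divided by the determinant. *)
Lemma Ck_on_invmx V n k (U : set V) (A : V -> 'M[R]_n) : open U ->
  (forall x, U x -> A x \in unitmx) ->
  (forall i j, Ck_on k U (fun x => A x i j)) ->
  forall i j, Ck_on k U (fun x => invmx (A x) i j).
Proof.
move=> oU uA cA i j.
apply: (@Ck_on_ext _ _ k U (fun x => (\det (A x))^-1 *
    ((-1) ^+ (j + i) * \det (row' j (col' i (A x)))))) => //.
  by move=> x /uA uAx; rewrite /invmx uAx !mxE.
apply: Ck_onM => //; first apply: Ck_onV => //.
- by move=> x /uA; rewrite unitmxE unitfE.
- exact: Ck_on_det.
- apply: Ck_onM => //; first exact: Ck_on_cst.
  apply: Ck_on_det => // i' j'.
  apply: (@Ck_on_ext _ _ k U (fun x => A x (lift j i') (lift i j'))) => //.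
  by move=> x _; rewrite !mxE.
Qed.

Lemma Ck_on_mulmx V m n q k (U : set V) (A : V -> 'M[R]_(m, n))
    (B : V -> 'M[R]_(n, q)) : open U ->
  (forall i j, Ck_on k U (fun x => A x i j)) ->
  (forall i j, Ck_on k U (fun x => B x i j)) ->
  forall i j, Ck_on k U (fun x => (A x *m B x) i j).
Proof.
move=> oU cA cB i j.
apply: (@Ck_on_ext _ _ k U (fun x => \sum_l A x i l * B x l j)) => //.
  by move=> x _; rewrite mxE.
by apply: Ck_on_sum => // l; exact: Ck_onM.
Qed.

End SmoothCalculus.

(** * Jacobi's formula and simple kernels *)

Section DerivativeOfDeterminant.
Variable R : realType.

Lemma is_derive_big_sum (V W : normedModType R) (I : Type) (r : seq I)
    (f : I -> V -> W) (df : I -> W) x v :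
  (forall i, is_derive x v (f i) (df i)) ->
  is_derive x v (fun y => \sum_(i <- r) f i y) (\sum_(i <- r) df i).
Proof.
move=> fdf; elim: r => [|i r IH].
  by rewrite big_nil; under eq_fun do rewrite big_nil; exact: is_derive_cst.
rewrite big_cons; under eq_fun do rewrite big_cons.
exact: is_deriveD.
Qed.

Lemma is_derive_big_prod (V : normedModType R) n (f : 'I_n -> V -> R)
    (df : 'I_n -> R) x v :
  (forall i, is_derive x v (f i) (df i)) ->
  is_derive x v (fun y => \prod_i f i y)
    (\sum_i \prod_j (if j == i then df j else f j x)).
Proof.
elim: n f df => [|n IH] f df fdf.
  by rewrite big_ord0; under eq_fun do rewrite big_ord0; exact: is_derive_cst.
under eq_fun do rewrite big_ord_recl.
have := is_deriveM (fdf ord0) (IH _ _ (fun i => fdf (lift ord0 i))).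
move/is_derive_eq; apply.
rewrite big_ord_recl addrC; congr (_ + _).
  by rewrite big_ord_recl/= mulrC.
rewrite /GRing.scale/= mulr_sumr; apply: eq_bigr => i _.
by rewrite big_ord_recl/=; congr (_ * _).
Qed.

Lemma is_derive_det (V : normedModType R) n (A : V -> 'M[R]_n) (A' : 'M[R]_n) x v :
  (forall i j, is_derive x v (fun y => A y i j) (A' i j)) ->
  is_derive x v (fun y => \det (A y)) (\tr (A' *m \adj (A x))).
Proof.
move=> dA.
have := is_derive_big_sum (index_enum {perm 'I_n})
  (fun s : {perm 'I_n} => is_deriveZ ((-1) ^+ s : R)
     (is_derive_big_prod (fun i => dA i (s i)))).
move/is_derive_eq; apply.
(* [B i] is [A x] with row [i] replaced by that of [A']. The differentiated Leibniz expansion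
   regroups into the determinants of the [B i], each then expanded along row [i]. *)
pose B i := \matrix_(j, k) (if j == i then A' j k else A x j k).
transitivity (\sum_i \det (B i)).
  rewrite exchange_big/=; apply: eq_bigr => s _.
  rewrite /GRing.scale/= mulr_sumr; apply: eq_bigr => i _.
  by congr (_ * _); apply: eq_bigr => j _; rewrite mxE.
rewrite /mxtrace; apply: eq_bigr => i _.
rewrite (expand_det_row _ i) !mxE; apply: eq_bigr => k _.
rewrite !mxE eqxx; congr (_ * (_ * \det _)).
by apply/matrixP => a b; rewrite !mxE eq_sym (negPf (neq_lift _ _)).
Qed.

(** A product rule for a merely continuous [r]: as [f] vanishes at [x], the difference quotient of
    the product is that of [f] times a value of [r]. *)
Lemma is_derive_mul_zero (V : normedModType R) (f r : V -> R) (df : R) x v :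
  is_derive x v f df -> f x = 0 -> {for x, continuous r} ->
  is_derive x v (fun y => f y * r y) (df * r x).
Proof.
move=> fdf fx0 cr.
have H : (fun h => h^-1 *: (((fun y => f y * r y) \o shift x) (h *: v) -
    f x * r x)) @ 0^' --> df * r x.
  have -> : (fun h => h^-1 *: (((fun y => f y * r y) \o shift x) (h *: v) -
      f x * r x)) = (fun h => h^-1 *: ((f \o shift x) (h *: v) - f x) *
        r (h *: v + x)).
    by apply/funext => h; rewrite /= fx0 mul0r !subr0 /GRing.scale/= mulrA.
  apply: cvgM.
    have [dfx <-] := fdf; exact: dfx.
  have : {for 0, continuous (fun h : R => r (h *: v + x))}.
    apply: continuous_comp; last by rewrite /= scale0r add0r.
    apply: cvgD; last exact: cvg_cst.
    by apply: scalel_continuous.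
  by move=> /continuous_withinNx; rewrite scale0r add0r.
apply: DeriveDef; first by apply/cvg_ex; exists (df * r x); exact: H.
exact: cvg_lim H.
Qed.

End DerivativeOfDeterminant.

(** * Adjugates of rank one *)

Section SimpleEigenvalue.

(** A nonzero cofactor exhibits an invertible submatrix of size [n.-1]. *)
Lemma mxrank_cofactor (F : fieldType) n (A : 'M[F]_n) i j :
  cofactor A i j != 0 -> (n.-1 <= \rank A)%N.
Proof.
rewrite mulf_eq0 negb_or => /andP[_ /negPf dA].
have rA : \rank (row' i (col' j A)) = n.-1.
  by apply: mxrank_unit; rewrite unitmxE unitfE dA.
rewrite -[X in (X <= _)%N]rA row'Esub.
apply: (leq_trans (mxrankS (rowsub_sub _ _))).
by rewrite -mxrank_tr tr_col' row'Esub -[X in (_ <= X)%N]mxrank_tr mxrankS ?rowsub_sub.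
Qed.

(** Since [\det B = 0], the rows of the adjugate lie in the left kernel of [B]. A nonzero adjugate
    forces rank at least [n.-1], so this kernel is the line spanned by [u]. *)
Lemma adj_sub_kernel (F : fieldType) n (B : 'M[F]_n) (u : 'rV_n) :
  u *m B = 0 -> u != 0 -> \adj B != 0 -> (\adj B <= u)%MS.
Proof.
move=> uB u0 aB0.
have /eqP dB : \det B == 0 by apply/det0P; exists u.
have [[i j] /= Bij] : exists ij : 'I_n * 'I_n, cofactor B ij.1 ij.2 != 0.
  apply/existsP; apply: contraNT aB0; rewrite negb_exists => /forallP aB.
  by apply/eqP/matrixP => i j; have /negPn/eqP := aB (j, i); rewrite !mxE.
have uK : (u <= kermx B)%MS by apply/sub_kermxP.
have aBK : (\adj B <= kermx B)%MS.
  by apply/sub_kermxP; rewrite mul_adj_mx dB raddf0.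
apply: submx_trans aBK _.
rewrite -(mxrank_leqif_sup uK) eqn_leq mxrankS//= rank_rV u0 mxrank_ker.
have n0 : (0 < n)%N := leq_ltn_trans (leq0n i) (ltn_ord i).
by rewrite leq_subLR addn1 -[X in (X <= _)%N](prednK n0) ltnS (mxrank_cofactor Bij).
Qed.

(** The kernel argument for [B] and for its transpose makes the rows of the adjugate multiples of
    [u] and its columns multiples of [w]. Hence it is a multiple of [w *m u], which has trace 1, and
    the trace gives the factor. *)
Lemma adj_simple_kernel (F : fieldType) n (B : 'M[F]_n) (u : 'rV_n) (w : 'cV_n) :
  u *m B = 0 -> B *m w = 0 -> u *m w = 1%:M -> \tr (\adj B) != 0 ->
  \adj B = \tr (\adj B) *: (w *m u).
Proof.
move=> uB Bw uw tr0.
have one0 : (1%:M : 'M[F]_1) != 0.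
  by apply/eqP => /matrixP/(_ 0 0); rewrite !mxE eqxx; apply/eqP; rewrite oner_eq0.
have aB0 : \adj B != 0 by apply: contraNneq tr0 => ->; rewrite raddf0.
have u0 : u != 0 by apply: contraNneq one0 => u0; rewrite -uw u0 mul0mx.
have w0 : w^T != 0.
  by apply: contraNneq one0 => /(canRL (@trmxK _ _ _)) w0; rewrite -uw w0 trmx0 mulmx0.
have /submxP[z zE] := adj_sub_kernel uB u0 aB0.
have /submxP[y yE] : (\adj B^T <= w^T)%MS.
  apply: adj_sub_kernel => //; first by rewrite -trmx_mul Bw trmx0.
  rewrite -trmx_adj; apply: contraNneq aB0 => /(canRL (@trmxK _ _ _)) ->.
  by rewrite trmx0.
have {}yE : \adj B = w *m y^T by rewrite -[LHS]trmxK trmx_adj yE trmx_mul trmxK.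
have E : \adj B = (y^T *m w) 0 0 *: (w *m u).
  rewrite -[LHS]mulmx1.
  have -> : \adj B *m 1%:M = \adj B *m (w *m u).
    by rewrite mulmx1 zE -!mulmxA [u *m (w *m u)]mulmxA uw mul1mx.
  rewrite yE -[in LHS]mulmxA [y^T *m (_ *m _)]mulmxA.
  by rewrite [in LHS](mx11_scalar (y^T *m w)) mul_scalar_mx -scalemxAr.
rewrite {2}E mxtraceZ mxtrace_mulC uw mxtrace1 mulr1; exact: E.
Qed.

End SimpleEigenvalue.

(** * Continuity of ordered eigenvalues *)

Section OrderedEigenvalues.
Variables (R : realType) (n : nat).
Implicit Types (A : 'M[R]_n) (m : 'I_n -> R).

Lemma horner_char_poly A x : (char_poly A).[x] = \det (x%:M - A).
Proof.
rewrite horner_sum; apply: eq_bigr => s _.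
rewrite hornerM horner_exp !hornerE; congr (_ * _).
rewrite (big_morph _ (fun p q => hornerM p q x) (hornerC 1 x)).
by apply: eq_bigr => i _; rewrite !mxE !(hornerE, hornerMn).
Qed.

Lemma det_ordered_eigenvalues A m x : ordered_eigenvalues A m ->
  \det (x%:M - A) = \prod_i (x - m i).
Proof.
move=> [_ Am]; rewrite -horner_char_poly Am horner_prod.
by apply: eq_bigr => i _; rewrite hornerXsubC.
Qed.

Lemma ordered_eigenvalues_eigenvalue A m a : ordered_eigenvalues A m ->
  eigenvalue A a <-> exists i, a = m i.
Proof.
move=> Am; rewrite eigenvalue_root_char rootE horner_char_poly.
rewrite (det_ordered_eigenvalues _ Am); split.
  by move=> /prodf_eq0[i _]; rewrite subr_eq0 => /eqP; exists i.
by move=> [i ->]; apply/prodf_eq0; exists i; rewrite ?subrr.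
Qed.

Lemma det_prod_eigenvalues A m : ordered_eigenvalues A m ->
  \det A = \prod_i m i.
Proof.
move=> Am; have := det_ordered_eigenvalues 0 Am.
rewrite raddf0 sub0r -scaleN1r detZ.
under eq_bigr do rewrite sub0r -mulN1r.
rewrite big_split/= big_const_ord iter_mulr_1 => /mulfI; apply.
by rewrite signr_eq0.
Qed.

Lemma ordered_eigenvalues_ext A B m : char_poly A = char_poly B ->
  ordered_eigenvalues A m -> ordered_eigenvalues B m.
Proof. by move=> AB [om Am]; split=> //; rewrite -AB. Qed.

(** Compare both sides of [v *m A = a *: v] at the coordinate of [v] of largest modulus. The bound
    is crude but confines the eigenvalues of nearby matrices to a compact set. *)
Lemma norm_eigenvalue_le A a : eigenvalue A a ->
  `|a| <= \sum_i \sum_j `|A i j|.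
Proof.
case/eigenvalueP => v vA v0.
have [i0 vi0] : exists i, v 0 i != 0 by apply/rV0Pn.
pose j := [arg max_(i > i0) `|v 0 i|]%O.
have vj i : `|v 0 i| <= `|v 0 j|.
  by rewrite /j; case: arg_maxP => //= k _ /(_ i isT).
have vj0 : 0 < `|v 0 j| by apply: lt_le_trans (vj i0); rewrite normr_gt0.
have /matrixP/(_ 0 j) := vA; rewrite !mxE => E.
rewrite -(ler_pM2r vj0) -normrM -E.
apply: (le_trans (ler_norm_sum _ _ _)); rewrite mulr_suml; apply: ler_sum => i _.
rewrite normrM mulrC.
apply: (le_trans (ler_wpM2l (normr_ge0 _) (vj i))); rewrite ler_wpM2r//.
by rewrite (bigD1 j)//= lerDl sumr_ge0.
Qed.

(** Unique factorization makes the two lists permutations of each other, and sorted permutations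
    coincide. *)
Lemma ordered_roots_unique m m' :
  (forall i j : 'I_n, (i <= j)%N -> m j <= m i) ->
  (forall i j : 'I_n, (i <= j)%N -> m' j <= m' i) ->
  \prod_(i < n) ('X - (m i)%:P) = \prod_(i < n) ('X - (m' i)%:P) -> m =1 m'.
Proof.
have srt (m0 : 'I_n -> R) : (forall i j : 'I_n, (i <= j)%N -> m0 j <= m0 i) ->
    sorted >=%R (map m0 (enum 'I_n)).
  move=> om; rewrite sorted_map.
  apply: (@sub_sorted _ (relpre val leq)) => [i j /= ij|]; first exact: om.
  by rewrite -sorted_map val_enum_ord iota_sorted.
move=> om om' E i.
have /eq_in_map : map m (enum 'I_n) = map m' (enum 'I_n).
  apply: (@sorted_eq _ >=%R) (srt _ om) (srt _ om') _.
  - by move=> y x z /= yx zy; exact: le_trans zy yx.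
  - by move=> x y /= /andP[yx xy]; apply/le_anti/andP.
  - by apply: prod_XsubC_eq; rewrite !big_map -!enumT in E *; rewrite !big_enum.
by apply; rewrite mem_enum.
Qed.

(** [Phi c] is a cluster point of the values of [Phi] along [M], and in a Hausdorff space the limit
    is the only one. *)
Lemma cluster_map_cvg (T : topologicalType) (V W : normedModType R) (M : T -> V)
    (Phi : V -> W) (t : T) c l :
  {for c, continuous Phi} -> Phi (M s) @[s --> t] --> l ->
  cluster (M @ t) c -> Phi c = l.
Proof.
move=> cPhi Ml cM; symmetry; apply: norm_hausdorff => A B lA cB.
have [v [Av Bv]] := cM (Phi @^-1` A) (Phi @^-1` B) (Ml _ lA) (cPhi _ cB).
by exists (Phi v).
Qed.

Lemma continuous_ordered_eigenvalues (A : R -> 'M[R]_n) (A' : 'M[R]_n)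
    (m : R -> 'I_n -> R) (t : R) :
  (forall i j, is_derive t 1 (fun s => A s i j) (A' i j)) ->
  (\near t, ordered_eigenvalues (A t) (m t)) ->
  forall i, {for t, continuous (fun s => m s i)}.
Proof.
move=> dA oA.
have cA i j : {for t, continuous (fun s => A s i j)}.
  apply: differentiable_continuous; apply/derivable1_diffP.
  by have [] := dA i j.
pose M s : 'rV[R]_n := \row_i m s i.
(* Near [t] the absolute value of each entry grows by at most 1, so [C] bounds all the eigenvalues
   there. *)
pose C := \sum_i \sum_j (`|A t i j| + 1).
have mC : \forall s \near t, forall i, `|m s i| <= C.
  have AC : \forall s \near t, forall ij : 'I_n * 'I_n,
      `|A s ij.1 ij.2| <= `|A t ij.1 ij.2| + 1.
    near=> s; move=> ij; move: ij; near: s; apply: filter_forall => ij.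
    have /cvgr_norm_le : A s ij.1 ij.2 @[s --> t] --> A t ij.1 ij.2 by exact: cA.
    by apply; rewrite ltrDl.
  near=> s; have ACs : forall ij : 'I_n * 'I_n,
      `|A s ij.1 ij.2| <= `|A t ij.1 ij.2| + 1 by near: s; exact: AC.
  move=> i.
  apply: (le_trans (norm_eigenvalue_le (A := A s) _)).
    apply/(ordered_eigenvalues_eigenvalue (m := m s)); last by exists i.
    by near: s.
  apply: ler_sum => k _; apply: ler_sum => j _.
  exact: ACs (k, j).
(* The margin of 1 makes the compact box [V] a neighbourhood of [M t]. *)
pose V := [set v : 'rV[R]_n | forall i, `[- (C + 1), C + 1]%classic (v ord0 i)].
have cV : compact V.
  apply: (@rV_compact R n (fun=> `[- (C + 1), C + 1]%classic)).
  by move=> i; exact: segment_compact.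
have nV : nbhs (M t) V.
  apply/nbhs_ballP; exists 1 => //= v [_ vb] i; have := vb ord0 i.
  rewrite mxE /ball/= => vi; rewrite in_itv/= -ler_norml.
  rewrite -[v ord0 i](subrK (m t i)) addrC (le_trans (ler_normD _ _))//.
  by rewrite lerD ?(nbhs_singleton mC)// distrC ltW.
have FV : (M @ t) V.
  apply: filterS mC => s ms i; rewrite /V/= in_itv/= -ler_norml mxE.
  by rewrite (le_trans (ms i))// lerDl.
suff cM : M @ t --> M t.
  move=> i; have := continuous_comp cM (@coord_continuous R 1 n ord0 i (M t)).
  suff -> : (fun v : 'rV[R]_n => v ord0 i) \o M = (fun s => m s i) by [].
  by apply/funext => s; rewrite /= mxE.
(* By compactness it is enough that [M t] be the only cluster point. *)
apply: (compact_cluster_set1 _ cV nV) => //.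
  exact: fmap_proper_filter (nbhs_pfilter t).
apply/seteqP; split=> [c Mc|c ->]; last first.
  move=> X Y MX nY; exists (M t).
  by split; [exact: nbhs_singleton MX|exact: nbhs_singleton nY].
have cc k : {for c, continuous (fun v : 'rV[R]_n => v ord0 k)}.
  exact: coord_continuous.
(* A violated inequality would hold on a whole neighbourhood of [c], which the ordered lists [M s]
   avoid. *)
have oc (i j : 'I_n) : (i <= j)%N -> c ord0 j <= c ord0 i.
  move=> ij; rewrite leNgt; apply/negP => cij.
  have cPhi : {for c, continuous (fun v : 'rV[R]_n => v ord0 i - v ord0 j)}.
    exact: (cvgB (cc i) (cc j)).
  have [v [/= Av Bv]] : [set v : 'rV[R]_n | v ord0 j <= v ord0 i] `&`
      [set v : 'rV[R]_n | v ord0 i - v ord0 j < 0] !=set0.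
    apply: Mc.
      by apply: filterS oA => s [+ _]; rewrite /= !mxE; exact.
    by have := cvgr_lt _ cPhi; apply; rewrite subr_lt0.
  by move: Bv; rewrite subr_lt0 ltNge Av.
(* Along the path the product is [\det (x%:M - A s)], which tends to its value at [t]. *)
have Pc x : \prod_i (x - c ord0 i) = \prod_i (x - m t i).
  pose Phi (v : 'rV[R]_n) := \prod_i (x - v ord0 i).
  have cPhi : {for c, continuous Phi}.
    have : Ck_on 0 setT Phi.
      apply: Ck_on_prod openT _ => i v _.
      exact: (cvgB (cvg_cst x) (@coord_continuous R 1 n ord0 i v)).
    by move/(_ c I).
  have := nbhs_singleton oA => /(det_ordered_eigenvalues x) <-.
  apply: (cluster_map_cvg cPhi _ Mc).
  have cd : {for t, continuous (fun s => \det (x%:M - A s))}.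
    apply: differentiable_continuous; apply/derivable1_diffP.
    have dB i j : is_derive t 1 (fun s => (x%:M - A s) i j) ((- A') i j).
      have -> : (fun s => (x%:M - A s) i j) = cst (x%:M i j) - (fun s => A s i j).
        by apply/funext => s; rewrite !mxE.
      apply: (is_derive_eq (is_deriveB (is_derive_cst _ _ _) (dA i j))).
      by rewrite mxE sub0r.
    by have [] := is_derive_det dB.
  apply: cvg_trans cd; apply: near_eq_cvg; near=> s.
  rewrite (@det_ordered_eigenvalues _ (m s)); last by near: s.
  by apply: eq_bigr => i _; rewrite mxE.
apply/rowP => i; rewrite mxE.
apply: (@ordered_roots_unique (fun i => c ord0 i)) => //.
  by have [] := nbhs_singleton oA.
(* The two polynomials agree at every real point, so their difference [P] vanishes at the [size P]
   distinct numbers 0, 1, ..., which is more than its degree allows unless it is zero. *)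
apply/eqP; rewrite -subr_eq0; apply/eqP; set P := _ - _.
pose r : seq R := [seq k%:R | k <- iota 0 (size P)].
apply: (@roots_geq_poly_eq0 _ _ r).
- apply/allP => x _; rewrite rootE !hornerE !horner_prod.
  under eq_bigr do rewrite hornerXsubC.
  under [X in _ - X]eq_bigr do rewrite hornerXsubC.
  by rewrite Pc subrr.
- by rewrite map_inj_uniq ?iota_uniq// => j k /eqP; rewrite eqr_nat => /eqP.
- by rewrite size_map size_iota.
Unshelve. all: by end_near. Qed.

End OrderedEigenvalues.

(** * Self-adjoint operators and simple eigenvalues *)

Section InnerProduct.
Variables (R : realType) (n : nat) (b : 'rV[R]_n -> 'rV[R]_n -> R).
Hypothesis ib : inner_product b.

Lemma inner_product_linear a u v w : b (a *: u + v) w = a * b u w + b v w.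
Proof. by case: ib. Qed.

Lemma inner_product_sym u v : b u v = b v u.
Proof. by case: ib. Qed.

Lemma inner_product_pos u : u != 0 -> 0 < b u u.
Proof. by case: ib => _ _; apply. Qed.

Lemma inner_product0 w : b 0 w = 0.
Proof.
have := inner_product_linear 1 0 0 w; rewrite scale1r addr0 mul1r.
by move=> b0; apply: (addrI (b 0 w)); rewrite addr0 -b0.
Qed.

Lemma inner_productZ a u w : b (a *: u) w = a * b u w.
Proof. by rewrite -[a *: u]addr0 inner_product_linear inner_product0 addr0. Qed.

Lemma inner_productD u v w : b (u + v) w = b u w + b v w.
Proof. by rewrite -[u in LHS]scale1r inner_product_linear mul1r. Qed.

Lemma inner_product_mulmx m (v : 'rV[R]_m) (E : 'M[R]_(m, n)) u :
  b (v *m E) u = \sum_i v 0 i * b (row i E) u.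
Proof.
rewrite mulmx_sum_row (big_morph (b ^~ u) (fun x y => inner_productD x y u)
  (inner_product0 u)).
by apply: eq_bigr => i _; rewrite inner_productZ.
Qed.

(** The column is the [b]-dual of [u]; it later serves as the right eigenvector matching a left
    eigenvector [u]. *)
Lemma inner_product_row v u :
  b v u = (v *m \col_i b (delta_mx 0 i) u) 0 0.
Proof.
rewrite -[v in LHS]mulmx1 inner_product_mulmx mxE.
by apply: eq_bigr => i _; rewrite row1 mxE.
Qed.

Variables (G : 'M[R]_n).
Hypothesis selfadj : forall x y, b (x *m G) y = b x (y *m G).

(** The polynomial splits over the complex numbers. Splitting a complex eigenvector into real and
    imaginary parts, self-adjointness forces the eigenvalue to be real, so the factorization
    descends to [R]. *)
Lemma selfadjoint_char_poly_splits :
  exists r : seq R, char_poly G = \prod_(z <- r) ('X - z%:P).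
Proof.
pose C : closedFieldType := complex.complex R.
pose tC : {rmorphism R -> C} := @complex.real_complex_def R (Phant R).
have [r rE] := closed_field_poly_normal (map_poly tC (char_poly G) : {poly C}).
have {rE}rE : map_poly tC (char_poly G) = \prod_(z <- r) ('X - z%:P).
  by rewrite [LHS]rE lead_coef_map (monicP (char_poly_monic G)) rmorph1 scale1r.
have real z : z \in r -> exists a, z = tC a.
  move=> zr; have /eigenvalueP[w wG w0] : eigenvalue (map_mx tC G) z.
    by rewrite eigenvalue_root_char -map_char_poly rE root_prod_XsubC.
  exists (complex.Re z).
  pose x := map_mx (@complex.Re R) w; pose y := map_mx (@complex.Im R) w.
  have xG : x *m G = complex.Re z *: x - complex.Im z *: y.
    apply/rowP => j; have /rowP/(_ j)/(congr1 (@complex.Re R)) := wG.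
    rewrite !mxE (big_morph (@complex.Re R) (id1 := 0) (op1 := +%R)) //; last first.
      by case=> ? ? [].
    case: z {zr wG} => p q /=; case: (w 0 j) => /= c d <-.
    apply: eq_bigr => i _; rewrite !mxE.
    by case: (w 0 i) => /= ? ?; rewrite mulr0 subr0.
  have yG : y *m G = complex.Im z *: x + complex.Re z *: y.
    apply/rowP => j; have /rowP/(_ j)/(congr1 (@complex.Im R)) := wG.
    rewrite !mxE (big_morph (@complex.Im R) (id1 := 0) (op1 := +%R)) //; last first.
      by case=> ? ? [].
    case: z {zr wG xG} => p q /=; case: (w 0 j) => /= c d; rewrite addrC => <-.
    apply: eq_bigr => i _; rewrite !mxE.
    by case: (w 0 i) => /= ? ?; rewrite mulr0 add0r.
  suff : complex.Im z = 0 by case: (z) => ? ? /= ->.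
  (* In [b (x *m G) y = b x (y *m G)] the terms with the real part of [z] cancel; the remaining
     factor is positive because [w] is nonzero. *)
  have E : complex.Im z * (b x x + b y y) = 0.
    have := selfadj x y; rewrite xG yG [b x _]inner_product_sym !inner_productD.
    rewrite -!scaleNr !inner_productZ [b y x]inner_product_sym [RHS]addrC.
    by move=> /addrI H; rewrite mulrDr -H mulNr addNr.
  have [/eqP//|Im0] := boolP (complex.Im z == 0).
  exfalso; move: E => /eqP; rewrite mulf_eq0 (negPf Im0)/=; apply/negP.
  rewrite gt_eqF//.
  have pos u : 0 <= b u u.
    by have [->|/inner_product_pos/ltW//] := eqVneq u 0; rewrite inner_product0.
  have [x0|x0] := eqVneq x 0; last by rewrite ltr_wpDr ?inner_product_pos.
  have [y0|y0] := eqVneq y 0; last by rewrite ltr_wpDl ?inner_product_pos.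
  case/negP: w0; apply/eqP/rowP => j; rewrite mxE.
  have := congr1 (fun u : 'rV_n => u 0 j) x0.
  have := congr1 (fun u : 'rV_n => u 0 j) y0.
  by rewrite !mxE; case: (w 0 j) => /= ? ? -> ->.
exists (map (@complex.Re R) r).
apply: (map_poly_inj tC); rewrite rE rmorph_prod big_map; apply: eq_big_seq => z zr /=.
by rewrite map_polyXsubC; have [a ->] := real z zr.
Qed.

Lemma selfadjoint_ordered_eigenvalues : exists m, ordered_eigenvalues G m.
Proof.
have [r rE] := selfadjoint_char_poly_splits.
have sr : size r = n.
  by apply: succn_inj; rewrite -(size_char_poly G) rE size_prod_XsubC.
exists (fun i => nth 0 (sort >=%R r) i); split.
  move=> i j ij; have := @sorted_leq_nth _ (>=%R : rel R).
  apply=> //; rewrite ?inE ?size_sort ?sr//.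
  - by move=> y x z /= yx zy; exact: le_trans zy yx.
  - by move=> x /=.
  - by apply: sort_sorted => x y; rewrite /= orbC le_total.
rewrite rE (perm_big (sort >=%R r)) /=; last by rewrite perm_sym perm_sort.
rewrite (big_nth 0) size_sort sr.
by rewrite big_mkord.
Qed.

End InnerProduct.

(** * Derivative of a simple eigenvalue *)

Section SimpleEigenvalueDerivative.
Variables (R : realType) (n : nat).

Lemma simple_eigenvalue_neq (A : 'M[R]_n) m i :
  ordered_eigenvalues A m -> simple_eigenvalue A (m i) ->
  forall j, j != i -> m j != m i.
Proof.
move=> [_ Am]; rewrite /simple_eigenvalue Am => mu1 j ji; apply/eqP => mji.
have : ('X - (m i)%:P) ^+ 2 %| \prod_(k < n) ('X - (m k)%:P).
  rewrite (bigD1 i)//= (bigD1 j)//= mji mulrA -expr2.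
  exact: dvdp_mulr.
rewrite -mup_geq ?mu1//.
by rewrite monic_neq0// monic_prod_XsubC.
Qed.

(** Both sides are the derivative of the characteristic polynomial at [m i], by Jacobi's formula and
    by the product rule. In the latter only the term that differentiates the vanishing factor
    survives. *)
Lemma trace_adj_simple (A : 'M[R]_n) m i : ordered_eigenvalues A m ->
  \tr (\adj ((m i)%:M - A)) = \prod_(j | j != i) (m i - m j).
Proof.
move=> Am; set x := m i.
have d1 : is_derive x 1 (fun y : R => \det (y%:M - A)) (\tr (1%:M *m \adj (x%:M - A))).
  apply: is_derive_det => k l.
  have -> : (fun y => (y%:M - A) k l) = (k == l)%:R \*: (id : R -> R) - cst (A k l).
    by apply/funext => y; rewrite !mxE -[y *+ _]mulr_natl.
  apply: is_derive_eq.
  by rewrite subr0 mxE [LHS]mulr1.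
have d2 : is_derive x 1 (fun y : R => \prod_j (y - m j))
    (\sum_k \prod_j (if j == k then 1 - 0 else x - m j)).
  by apply: is_derive_big_prod => j; exact: is_deriveB.
have E : (fun y => \det (y%:M - A)) = (fun y : R => \prod_j (y - m j)).
  by apply/funext => y; exact: det_ordered_eigenvalues.
rewrite E in d1; rewrite -[\adj _]mul1mx -(derive_val (is_derive := d1)).
rewrite (derive_val (is_derive := d2)) (bigD1 i)//= [X in _ + X]big1 ?addr0.
  by rewrite (bigD1 i)//= eqxx subr0 mul1r; apply: eq_bigr => j /negPf ->.
by move=> k ki; rewrite (bigD1 i)//= eq_sym (negPf ki) subrr mul0r.
Qed.

Lemma is_derive_simple_eigenvalue (A : R -> 'M[R]_n) (A' : 'M[R]_n)
    (m : R -> 'I_n -> R) (t : R) i (u : 'rV_n) (w : 'cV_n) :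
  (forall i j, is_derive t 1 (fun s => A s i j) (A' i j)) ->
  (\near t, ordered_eigenvalues (A t) (m t)) ->
  simple_eigenvalue (A t) (m t i) ->
  u *m A t = m t i *: u -> A t *m w = m t i *: w -> u *m w = 1%:M ->
  is_derive t 1 (fun s => m s i) ((u *m A' *m w) 0 0).
Proof.
move=> dA oA simple uA Aw uw; set l := m t i.
have oAt := nbhs_singleton oA.
have cm := continuous_ordered_eigenvalues dA oA.
(* The characteristic polynomial of [A s] at [l], deprived of the factor [l - m s i]; simplicity
   makes it nonzero at [t]. *)
pose q s := \prod_(j | j != i) (l - m s j).
have q0 : q t != 0.
  apply/prodf_neq0 => j ji; rewrite subr_eq0 eq_sym.
  exact: (simple_eigenvalue_neq oAt).
have trq : \tr (\adj (l%:M - A t)) = q t by exact: trace_adj_simple i oAt.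
have cq : {for t, continuous q}.
  rewrite /q; elim: (index_enum _) => [|j r IH].
    have -> : (fun s => \prod_(j <- [::] | j != i) (l - m s j)) = cst 1.
      by apply/funext => s; rewrite big_nil.
    exact: cvg_cst.
  case ji : (j != i).
    have -> : (fun s => \prod_(k <- j :: r | k != i) (l - m s k)) =
        (fun s => (l - m s j) * \prod_(k <- r | k != i) (l - m s k)).
      by apply/funext => s; rewrite big_cons ji.
    exact: (cvgM (cvgB (cvg_cst l) (cm j)) IH).
  have -> // : (fun s => \prod_(k <- j :: r | k != i) (l - m s k)) =
      (fun s => \prod_(k <- r | k != i) (l - m s k)).
  by apply/funext => s; rewrite big_cons ji.
have dB j k : is_derive t 1 (fun s => (l%:M - A s) j k) ((- A') j k).
  have -> : (fun s => (l%:M - A s) j k) = cst (l%:M j k) - (fun s => A s j k).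
    by apply/funext => s; rewrite !mxE.
  apply: (is_derive_eq (is_deriveB (is_derive_cst _ _ _) (dA j k))).
  by rewrite mxE sub0r.
have f0 : \det (l%:M - A t) = 0.
  by rewrite (det_ordered_eigenvalues _ oAt) (bigD1 i)//= subrr mul0r.
have cV : {for t, continuous (fun s => (q s)^-1)} by exact: cvgV q0 cq.
have d := is_derive_mul_zero (is_derive_det dB) f0 cV.
have adjE : \adj (l%:M - A t) = q t *: (w *m u).
  rewrite -trq; apply: adj_simple_kernel => //; last by rewrite trq.
    by rewrite mulmxBr uA mul_mx_scalar subrr.
  by rewrite mulmxBl Aw mul_scalar_mx subrr.
(* Near [t], [m s i] is [l] minus the quotient of [\det (l%:M - A s)] by [q s]. *)
have {d} := is_deriveB (is_derive_cst l t 1) d.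
move/is_derive_eq => H; apply: near_eq_is_derive (H _ _).
  near=> s.
  have os : ordered_eigenvalues (A s) (m s) by near: s.
  have qs : q s != 0 by near: s; exact: (cvgr_neq0 (q t)).
  rewrite /= !fctE (det_ordered_eigenvalues _ os) (bigD1 i)//= mulfK//.
  by rewrite subKr.
(* The minus sign of this difference cancels that of [- A'], and the factor [q t] of the adjugate
   cancels its inverse. *)
rewrite sub0r adjE -scalemxAr mxtraceZ mulNmx raddfN/= mulrN mulNr opprK.
rewrite mulrAC divff// mul1r mulmxA mxtrace_mulC mulmxA.
by rewrite /mxtrace big_ord1.
Unshelve. all: by end_near. Qed.

End SimpleEigenvalueDerivative.

(** * Coordinate frames *)

Section CoordinateFrame.
Variables (R : realType) (n : nat) (S : manifold R n).
Implicit Types (a b c d : chart S) (p : S).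

Lemma open_chart_image c (O : set S) : open O -> open (phi c @` (dom c `&` O)).
Proof.
move=> oO; rewrite openE => _ [p [cp Op] <-].
have im : (phi c @` dom c) (phi c p) by exists p.
have Opsi : \forall y \near phi c p, O (psi c y).
  have := @psi_continuous R n S c _ im; rewrite /prop_for /continuous_at phiK//.
  by apply; exact: open_nbhs_nbhs.
have := open_nbhs_nbhs (conj (@phi_open R n S c) im); rewrite /interior.
apply: filterS2 Opsi => y Oy [q cq qy]; exists q => //.
by split => //; rewrite -(phiK cq) qy.
Qed.

Let image_mem c (O : set S) p : dom c p -> O p ->
  (phi c @` (dom c `&` O)) (phi c p).
Proof. by move=> cp Op; exists p. Qed.

Lemma differentiable_transition a b p : dom a p -> dom b p ->
  differentiable (phi b \o psi a) (phi a p).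
Proof.
move=> ap bp; have [+ _] := @transition_smooth R n S a b 1%N.
by apply; exact: image_mem.
Qed.

(** The chain rule, as the middle chart cancels near [phi a p]. *)
Lemma derive_transition_comp a b c p v : dom a p -> dom b p -> dom c p ->
  'D_('D_v (phi b \o psi a) (phi a p)) (phi c \o psi b) (phi b p) =
  'D_v (phi c \o psi a) (phi a p).
Proof.
move=> ap bp cp; have fE : (phi b \o psi a) (phi a p) = phi b p by rewrite /= phiK.
rewrite -[in LHS]fE -derive_comp ?fE; [|exact: differentiable_transition..].
apply: near_eq_derive.
have oab := @open_chart_image a _ (@dom_open R n S b).
have := open_nbhs_nbhs (conj oab (image_mem ap bp)).
by apply: filterS => _ [q [aq bq] <-]; rewrite /= phiK// phiK.
Qed.

Lemma derive_transition_id a p v : dom a p ->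
  'D_v (phi a \o psi a) (phi a p) = v.
Proof.
move=> ap; rewrite -[RHS](derive_id (phi a p) v); apply: near_eq_derive.
have := open_nbhs_nbhs (conj (@phi_open R n S a) (imageP (phi a) ap)).
by apply: filterS => _ [q aq <-]; rewrite /= phiK.
Qed.

(* Off the domain of [c] the frame is the one of the preferred chart: this makes
   it invertible everywhere. *)
Definition frame_chart c p := if `[< dom c p >] then c else chart_at p.

(** For [p] in [dom c], the rows are the coordinate vectors of [c] at [p], written in the preferred
    chart as tangent vectors are. *)
Definition frame c p : 'M[R]_n :=
  jacobian (phi (chart_at p) \o psi (frame_chart c p)) (phi (frame_chart c p) p).

Lemma frame_chartP c p : dom (frame_chart c p) p.
Proof. by rewrite /frame_chart; case: asboolP => // _; exact: chart_atP. Qed.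

Lemma frame_chart_dom c p : dom c p -> frame_chart c p = c.
Proof. by move=> cp; rewrite /frame_chart asboolT. Qed.

Lemma mul_frame c p v : v *m frame c p =
  'D_v (phi (chart_at p) \o psi (frame_chart c p)) (phi (frame_chart c p) p).
Proof.
rewrite deriveEjacobian//; apply: differentiable_transition.
- exact: frame_chartP.
- exact: chart_atP.
Qed.

(** The inverse is the Jacobian of the reverse change of chart. *)
Lemma frame_unit c p : frame c p \in unitmx.
Proof.
pose J := jacobian (phi (frame_chart c p) \o psi (chart_at p)) (phi (chart_at p) p).
have cp := frame_chartP c p; have ap := @chart_atP R n S p.
suff EJ : frame c p *m J = 1%:M by exact: (proj1 (mulmx1_unit EJ)).
apply/row_matrixP => i; rewrite row_mul row1 rowE mul_frame.
rewrite -deriveEjacobian; last exact: differentiable_transition.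
by rewrite derive_transition_comp// derive_transition_id.
Qed.

Lemma frame_chart_at p : frame (chart_at p) p = 1%:M.
Proof.
have ap := @chart_atP R n S p.
apply/row_matrixP => i; rewrite row1 rowE mul_frame frame_chart_dom//.
exact: derive_transition_id.
Qed.

Lemma tangent_coord_frame a c p v : dom a p -> dom c p ->
  tangent_coord a (v *m frame c p : tangent p) = 'D_v (phi a \o psi c) (phi c p).
Proof.
move=> ap cp; rewrite /tangent_coord mul_frame frame_chart_dom//.
by rewrite derive_transition_comp//; exact: chart_atP.
Qed.

Lemma tangent_coord_mx a p (v : tangent p) : dom a p -> tangent_coord a v =
  v *m jacobian (phi a \o psi (chart_at p)) (phi (chart_at p) p).
Proof.
move=> ap; rewrite /tangent_coord deriveEjacobian//.
by apply: differentiable_transition => //; exact: chart_atP.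
Qed.

Lemma smooth_derive_transition c a v :
  smooth_on (phi c @` (dom c `&` dom a)) ('D_v (phi a \o psi c)).
Proof. by move=> k; have [_ /(_ v)] := @transition_smooth R n S c a k.+1. Qed.

Lemma smooth_frame c i :
  smooth_vector_field (dom c) (fun p => row i (frame c p) : tangent p).
Proof.
move=> a d k; set O := dom a `&` dom c.
have oO : open O by apply: openI; exact: dom_open.
(* In the chart [a] the frame vector is a partial derivative of the transition from [c]; the chart
   [d] only parametrizes the base point. *)
apply: (@Ck_on_ext _ _ _ _ _
  ('D_(delta_mx 0 i) (phi a \o psi c) \o (phi c \o psi d))).
- exact: open_chart_image.
- by move=> _ [q [dq [aq cq]] <-] /=; rewrite phiK// rowE tangent_coord_frame.
apply: (Ck_on_comp (O := phi c @` (dom c `&` dom a))).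
- exact: open_chart_image.
- exact/open_chart_image/dom_open.
- by move=> _ [q [dq [aq cq]] <-] /=; rewrite phiK//; exact: image_mem.
- apply: Ck_on_subset (@transition_smooth R n S d c k).
  by move=> _ [q [dq [aq cq]] <-]; exact: image_mem.
- exact: smooth_derive_transition.
Qed.

(** * Frames and covariant derivatives along a path *)

Section AlongPath.
Variables (J : set R) (p : R -> S).
Hypotheses (oJ : open J) (sp : smooth_path J p).

Lemma open_path_preimage (O : set S) : open O -> open (J `&` p @^-1` O).
Proof.
move=> oO; rewrite openE => t [Jt Opt]; have [cp _] := sp.
apply: filterI; first exact: open_nbhs_nbhs.
by apply: (cp t Jt); exact: open_nbhs_nbhs.
Qed.

Lemma smooth_map_along c (f : S -> R) : smooth_map (dom c) f ->
  smooth_on (J `&` p @^-1` dom c) (f \o p).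
Proof.
move=> sf k; have [_ cp] := sp.
apply: (@Ck_on_ext _ _ _ _ _ ((f \o psi c) \o (phi c \o p))).
- exact/open_path_preimage/dom_open.
- by move=> t [_ ct] /=; rewrite phiK.
apply: (Ck_on_comp_scalar (O := phi c @` (dom c `&` dom c))).
- exact/open_path_preimage/dom_open.
- by move=> t [_ ct]; exact: image_mem.
- exact: cp.
- exact: sf.
Qed.

Lemma smooth_along_frame c i :
  smooth_along (J `&` p @^-1` dom c) (fun t => row i (frame c (p t)) : tangent (p t)).
Proof.
move=> a k; have [_ cp] := sp.
have oK : open (J `&` p @^-1` dom c `&` p @^-1` dom a).
  by rewrite -setIA -preimage_setI; apply/open_path_preimage/openI; exact: dom_open.
apply: (@Ck_on_ext _ _ _ _ _
  ('D_(delta_mx 0 i) (phi a \o psi c) \o (phi c \o p))) => //.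
  by move=> t [[Jt ct] pa]; rewrite rowE tangent_coord_frame.
apply: (Ck_on_comp (O := phi c @` (dom c `&` dom a))) => //.
- exact/open_chart_image/dom_open.
- by move=> t [[Jt ct] pa]; exact: image_mem.
- by apply: Ck_on_subset (cp c k) => t [].
- exact: smooth_derive_transition.
Qed.

Lemma smooth_along_comb (I : Type) (r : seq I) (K : set R) (f : I -> R -> R)
    (V : I -> field_along p) : open K -> K `<=` J ->
  (forall i, smooth_on K (f i)) -> (forall i, smooth_along K (V i)) ->
  smooth_along K (fun t => \sum_(i <- r) f i t *: V i t : tangent (p t)).
Proof.
move=> oK KJ sf sV a k.
have oKa : open (K `&` p @^-1` dom a).
  (* Inserting [J] gives access to the continuity of [p], known at the points of [J]. *)
  rewrite (_ : _ `&` _ = K `&` (J `&` p @^-1` dom a)).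
    exact/openI/open_path_preimage/dom_open.
  by apply/seteqP; split=> [t [Kt pa]|t [Kt [_ pa]]]; split=> //; split=> //; exact: KJ.
apply: Ck_on_rV => // j.
apply: (@Ck_on_ext _ _ _ _ _
  (fun t => \sum_(i <- r) f i t * tangent_coord a (V i t) ord0 j)) => //.
  move=> t [_ pa]; rewrite tangent_coord_mx// mulmx_suml summxE.
  by apply: eq_bigr => i _; rewrite tangent_coord_mx// -scalemxAl [RHS]mxE.
apply: Ck_on_sum => // i; apply: Ck_onM => //.
  by apply: Ck_on_subset (sf i k) => t [].
exact/Ck_on_coord/sV.
Qed.

Lemma covariant_derivative_comb (nabla : connection_op S)
    (D : field_along p -> field_along p) (I : Type) (r : seq I) (K : set R)
    (f : I -> R -> R) (V : I -> field_along p) t :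
  is_covariant_derivative_along nabla J D ->
  open K -> K `<=` J -> K t ->
  (forall i, smooth_on K (f i)) -> (forall i, smooth_along K (V i)) ->
  D (fun s => \sum_(i <- r) f i s *: V i s : tangent (p s)) t =
  \sum_(i <- r) ('D_1 (f i) t *: V i t + f i t *: D (V i) t).
Proof.
move=> cD oK KJ Kt sf sV; elim: r => [|i r IH].
  have s0 : smooth_along K (fun s => 0 : tangent (p s)).
    move=> a k; apply: (@Ck_on_subset _ _ _ _ setT) => //.
    rewrite (_ : (fun _ => _) = cst 0); first exact: Ck_on_cst.
    by apply/funext => s; rewrite /tangent_coord derive0.
  have sc : smooth_on K (cst 0 : R -> R) by move=> k; exact: Ck_on_cst.
  have D0 := along_leibniz cD oK KJ sc s0 Kt.
  rewrite big_nil.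
  (* Writing the zero field as the zero function times itself, the Leibniz rule shows that [D] kills
     it. *)
  transitivity (D (fun s => cst 0 s *: (0 : tangent (p s))) t); last first.
    by rewrite D0 derive_cst scaler0 add0r; exact: scale0r.
   apply: (congr1 (D^~ t)); apply: functional_extensionality_dep => s.
  by rewrite big_nil scaler0.
rewrite big_cons -IH -(along_leibniz cD oK KJ)//.
rewrite -(along_add cD oK KJ)//.
- apply: (congr1 (D^~ t)); apply: functional_extensionality_dep => s.
  by rewrite big_cons.
- have := @smooth_along_comb _ [:: i] K f V oK KJ sf sV.
  rewrite (_ : (fun s => \sum_(j <- [:: i]) f j s *: V j s) =
    (fun s => f i s *: V i s))//.
  by apply: functional_extensionality_dep => s; rewrite big_seq1.
- exact: smooth_along_comb.
Qed.

End AlongPath.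

End CoordinateFrame.

(** * The Gram operator along a path *)

Section GramOperator.
Variables (R : realType) (n k : nat) (S : manifold R n).
Variables (Z : bundle_data S k) (hZ : forall p : S, fibre Z p -> fibre Z p -> R).
Variable F : forall p : S, tangent p -> fibre Z p.
Variables (g : forall p : S, tangent p -> tangent p -> R) (G : S -> 'M[R]_n).
Arguments g : clear implicits.
Hypothesis hZm : is_fibre_metric hZ.
Hypothesis Fm : is_tangent_morphism F.
Hypothesis gm : is_riemannian_metric g.
Hypothesis Gg : is_gram_operator g (response_metric hZ F) G.

Lemma metric_inner p : inner_product (g p : 'rV[R]_n -> 'rV[R]_n -> R).
Proof. exact: (fibre_metric_inner gm p). Qed.

Lemma gram_selfadjoint p (x y : 'rV[R]_n) : g p (x *m G p) y = g p x (y *m G p).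
Proof.
have [_ hsym _] := fibre_metric_inner hZm p.
by rewrite [RHS](inner_product_sym (metric_inner p)) !Gg /response_metric hsym.
Qed.

(** For an eigenvector [v], [a * g p v v] is the squared length of [F p v], which is nonzero by
    injectivity. *)
Lemma gram_eigenvalue_gt0 p a :
  complete_locus F p -> eigenvalue (G p) a -> 0 < a.
Proof.
move=> Fp /eigenvalueP[v vG v0].
have [_ _ hpos] := fibre_metric_inner hZm p.
have : 0 < g p (v *m G p) v.
  by rewrite Gg; apply: hpos; apply: contraNneq v0 => /Fp ->.
rewrite vG (inner_productZ (metric_inner p)) pmulr_lgt0//.
exact: (inner_product_pos (metric_inner p)).
Qed.

Lemma gram_ordered_eigenvalues p : exists m, ordered_eigenvalues (G p) m.
Proof.
exact: (selfadjoint_ordered_eigenvalues (metric_inner p) (@gram_selfadjoint p)).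
Qed.

Definition frame_gram (c : chart S) (b : forall p : S, tangent p -> tangent p -> R)
  (p : S) : 'M[R]_n := \matrix_(i, j) b p (row i (frame c p)) (row j (frame c p)).

Lemma frame_gram_metricE c p (v : 'rV[R]_n) j :
  (v *m frame_gram c g p) ord0 j = g p (v *m frame c p) (row j (frame c p)).
Proof.
have ig := metric_inner p.
by rewrite (inner_product_mulmx ig) mxE; apply: eq_bigr => i _; rewrite mxE.
Qed.

(** A null vector would be the component vector of a nonzero tangent vector of length zero. *)
Lemma frame_gram_unit c p : frame_gram c g p \in unitmx.
Proof.
have ig := metric_inner p.
rewrite unitmxE unitfE; apply/det0P => -[v v0 vg].
have vE0 : v *m frame c p != 0.
  apply: contraNneq v0 => /(congr1 (mulmxr (invmx (frame c p)))) /=.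
  by rewrite mulmxK ?frame_unit// mul0mx => ->.
have := inner_product_pos ig vE0.
rewrite (inner_product_mulmx ig) big1 ?ltxx// => i _.
by rewrite (inner_product_sym ig) -frame_gram_metricE vg mxE mulr0.
Qed.

Lemma frame_gram_smooth_along c (J : set R) (p : R -> S) i j :
  open J -> smooth_path J p ->
  smooth_on (J `&` p @^-1` dom c) (fun s => frame_gram c g (p s) i j) /\
  smooth_on (J `&` p @^-1` dom c)
    (fun s => frame_gram c (response_metric hZ F) (p s) i j).
Proof.
move=> oJ sp; have oc : open (dom c) by exact: dom_open.
split.
  have -> : (fun s => frame_gram c g (p s) i j) =
      (fun q => g q (row i (frame c q)) (row j (frame c q))) \o p.
    by apply/funext => s; rewrite mxE.
  apply: smooth_map_along => //.
  by apply: (fibre_metric_smooth gm oc); exact: smooth_frame.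
have -> : (fun s => frame_gram c (response_metric hZ F) (p s) i j) =
    (fun q => hZ (F (row i (frame c q) : tangent q))
      (F (row j (frame c q) : tangent q))) \o p.
  by apply/funext => s; rewrite mxE.
apply: smooth_map_along => //.
apply: (fibre_metric_smooth hZm oc (s := fun q => F (row i (frame c q) : tangent q))
  (s' := fun q => F (row j (frame c q) : tangent q)));
  apply: (morphism_smooth Fm oc (X := fun q => row _ (frame c q) : tangent q));
  exact: smooth_frame.
Qed.

(** The matrix of [G] in the frame of [c]. Whereas [G (p s)] refers to a preferred chart that may
    jump with [s], these entries vary smoothly while the path stays in [dom c]. *)
Definition frame_operator (c : chart S) (p : S) : 'M[R]_n :=
  frame c p *m G p *m invmx (frame c p).

Lemma mul_frame_operator c p : frame c p *m G p = frame_operator c p *m frame c p.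
Proof. by rewrite mulmxKV ?frame_unit. Qed.

Lemma char_poly_frame_operator c p : char_poly (frame_operator c p) = char_poly (G p).
Proof.
have Eu := frame_unit c p; set E := frame c p in Eu *.
have EuX : map_mx polyC E *m map_mx polyC (invmx E) = 1%:M.
  by rewrite -map_mxM mulmxV// map_mx1.
rewrite /char_poly.
have -> : char_poly_mx (frame_operator c p) =
    map_mx polyC E *m char_poly_mx (G p) *m map_mx polyC (invmx E).
  rewrite /char_poly_mx mulmxBr mulmxBl mul_mx_scalar -scalemxAl EuX scalemx1.
  by rewrite /frame_operator !map_mxM.
by rewrite !det_mulmx mulrAC -det_mulmx EuX det1 mul1r.
Qed.

Lemma det_frame_operator c p : \det (frame_operator c p) = \det (G p).
Proof. by rewrite !det_mulmx mulrAC -det_mulmx mulmxV ?frame_unit// det1 mul1r. Qed.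

(** Pairing with the frame vectors turns the defining relation of [G] into a matrix equation.
    Smoothness of the operator is read off from this formula. *)
Lemma frame_operatorE c p : frame_operator c p =
  frame_gram c (response_metric hZ F) p *m invmx (frame_gram c g p).
Proof.
apply: (canRL (mulmxK (frame_gram_unit c p))); apply/matrixP => i j.
have E : row i (frame_operator c p) *m frame c p = row i (frame c p) *m G p.
  by rewrite -!row_mul mul_frame_operator.
have := frame_gram_metricE c p (row i (frame_operator c p)) j.
rewrite E Gg -row_mul [LHS]mxE => ->.
by rewrite mxE.
Qed.

Lemma frame_operator_smooth_along c (J : set R) (p : R -> S) i j :
  open J -> smooth_path J p ->
  smooth_on (J `&` p @^-1` dom c) (fun s => frame_operator c (p s) i j).
Proof.
move=> oJ sp l.
have oK : open (J `&` p @^-1` dom c) by exact/open_path_preimage/dom_open.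
apply: (@Ck_on_ext _ _ _ _ _ (fun s =>
  (frame_gram c (response_metric hZ F) (p s) *m
   invmx (frame_gram c g (p s))) i j)) => //.
  by move=> s _; rewrite frame_operatorE.
apply: Ck_on_mulmx => // i' j'.
  by have [_ /(_ l)] := frame_gram_smooth_along c i' j' oJ sp.
apply: Ck_on_invmx => //; first by move=> s _; exact: frame_gram_unit.
by move=> a b; have [/(_ l)] := frame_gram_smooth_along c a b oJ sp.
Qed.

(** * Derivatives of the operator, its eigenvalues and its determinant *)

Section AlongPath.
Variables (nabla : connection_op S) (J : set R) (p : R -> S).
Variables (D : field_along p -> field_along p) (DG : R -> 'M[R]_n).
Hypotheses (oJ : open J) (sp : smooth_path J p).
Hypothesis cD : is_covariant_derivative_along nabla J D.
Hypothesis cDG : is_covariant_derivative_end J D (G \o p) DG.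
Variable t : R.
Hypothesis Jt : J t.
Let c := chart_at (p t).
Let K := J `&` p @^-1` dom c.
Let A s := frame_operator c (p s).

Let oK : open K. Proof. exact/open_path_preimage/dom_open. Qed.
Let Kt : K t. Proof. by split=> //; exact: chart_atP. Qed.
Let KJ : K `<=` J. Proof. by move=> s []. Qed.

Definition frame_operator_derivative : 'M[R]_n :=
  \matrix_(i, j) 'D_1 (fun s => A s i j) t.
Let A' := frame_operator_derivative.

Lemma frame_operator_at : A t = G (p t).
Proof. by rewrite /A /frame_operator frame_chart_at mul1mx invmx1 mulmx1. Qed.

Lemma is_derive_frame_operator i j : is_derive t 1 (fun s => A s i j) (A' i j).
Proof.
apply: DeriveDef; last by rewrite mxE.
apply/derivable1_diffP; have [+ _] := frame_operator_smooth_along c i j oJ sp 1%N.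
exact.
Qed.

(* In the frame the covariant derivative of the operator differs from the
   componentwise one by a commutator with the connection matrix. *)
Lemma covariant_derivative_frame_operator :
  exists Gamma : 'M[R]_n, DG t = A' + G (p t) *m Gamma - Gamma *m G (p t).
Proof.
pose V i : field_along p := fun s => row i (frame c (p s)).
have sV i : smooth_along K (V i) by exact: smooth_along_frame.
(* The connection matrix: its rows are the covariant derivatives at [t] of the frame fields, and the
   frame at [t] is the identity. *)
exists (\matrix_i (D (V i) t)); apply/row_matrixP => i.
have := cDG oK KJ (sV i) Kt.
have -> : V i t = delta_mx 0 i by rewrite /V frame_chart_at row1.
rewrite -rowE => ->.
have -> : (fun s => V i s *m (G \o p) s : tangent (p s)) =
    (fun s => \sum_j A s i j *: V j s : tangent (p s)).
  apply: functional_extensionality_dep => s.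
  rewrite /V /= -row_mul mul_frame_operator row_mul mulmx_sum_row.
  by apply: eq_bigr => j _; rewrite mxE.
rewrite (covariant_derivative_comb oJ sp _ cD oK KJ Kt _ sV); last first.
  by move=> j; exact: frame_operator_smooth_along.
rewrite raddfB raddfD/= !row_mul rowK big_split/=; congr (_ + _ - _).
  rewrite -[row i A']mulmx1 mulmx_sum_row; apply: eq_bigr => j _.
  by rewrite !mxE row1 /V frame_chart_at row1.
rewrite mulmx_sum_row; apply: eq_bigr => j _.
by rewrite rowK -frame_operator_at [in RHS]mxE.
Qed.

Lemma is_derive_gram_eigenvalue (mu : R -> 'I_n -> R) (i : 'I_n) (u : tangent (p t)) :
  (forall s, J s -> ordered_eigenvalues (G (p s)) (mu s)) ->
  simple_eigenvalue (G (p t)) (mu t i) ->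
  u *m G (p t) = mu t i *: u -> g (p t) u u = 1 ->
  is_derive t 1 (fun s => mu s i) (g (p t) (u *m DG t) u).
Proof.
move=> omu simple uG uu; have ig := metric_inner (p t).
pose w : 'cV[R]_n := \col_j g (p t) (delta_mx 0 j) u.
have gw v : g (p t) v u = (v *m w) 0 0 by exact: (inner_product_row ig).
(* Self-adjointness makes the dual of a left eigenvector a right eigenvector. *)
have Gw : G (p t) *m w = mu t i *: w.
  apply/colP => j; rewrite [RHS]mxE [w j 0]mxE -(inner_productZ ig).
  transitivity (((delta_mx 0 j : 'rV[R]_n) *m G (p t) *m w) 0 0).
    by rewrite -mulmxA -rowE [RHS]mxE.
  rewrite -gw gram_selfadjoint uG [LHS](inner_product_sym ig) !(inner_productZ ig).
  by rewrite [X in _ * X](inner_product_sym ig).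
have uw : u *m w = 1%:M by rewrite [LHS]mx11_scalar -gw uu.
have [Gamma DGE] := covariant_derivative_frame_operator.
(* Between [u] and [w] both terms of the commutator equal [mu t i] times [u *m Gamma *m w]. *)
have -> : g (p t) (u *m DG t) u = (u *m A' *m w) 0 0.
  rewrite gw DGE mulmxBr mulmxDr !mulmxBl !mulmxDl !mulmxA uG -!mulmxA Gw.
  by rewrite -!scalemxAl -!scalemxAr !mulmxA addrK.
apply: (is_derive_simple_eigenvalue (A := A)).
- exact: is_derive_frame_operator.
- have := open_nbhs_nbhs (conj oJ Jt); apply: filterS => s Js.
  apply: ordered_eigenvalues_ext (omu s Js).
  by rewrite char_poly_frame_operator.
- by rewrite frame_operator_at.
- by rewrite frame_operator_at.
- by rewrite frame_operator_at.
- exact: uw.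
Qed.

Lemma is_derive_ln_det_gram : complete_locus F (p t) ->
  is_derive t 1 (fun s => ln (\det (G (p s)))) (\tr (DG t *m invmx (G (p t)))).
Proof.
move=> Fp.
(* On the complete locus the determinant is a product of positive eigenvalues, so [ln] is
   differentiable there and [G (p t)] is invertible. *)
have det0 : 0 < \det (G (p t)).
  have [m om] := gram_ordered_eigenvalues (p t).
  rewrite (det_prod_eigenvalues om); apply: prodr_gt0 => i _.
  apply: (gram_eigenvalue_gt0 Fp).
  by apply/(ordered_eigenvalues_eigenvalue _ om); exists i.
have Gu : G (p t) \in unitmx by rewrite unitmxE unitfE gt_eqF.
have d := is_derive_det is_derive_frame_operator.
have {d} : is_derive t 1 (fun s => \det (G (p s))) (\tr (A' *m \adj (G (p t)))).
  rewrite -frame_operator_at; move: d; congr (is_derive t 1 _ _).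
  by apply/funext => s; exact: det_frame_operator.
move=> d; have := is_derive1_comp (is_derive1_ln det0) d.
move/is_derive_eq; apply.
(* By cyclicity of the trace the commutator contributes [\tr Gamma - \tr Gamma]; what remains uses
   that the inverse is the adjugate over the determinant. *)
have [Gamma ->] := covariant_derivative_frame_operator.
rewrite mulmxBl mulmxDl raddfB raddfD/= -[Gamma *m _ *m _]mulmxA mulmxV// mulmx1.
rewrite -[G _ *m _ *m _]mulmxA [\tr (G _ *m _)]mxtrace_mulC.
rewrite -[Gamma *m _ *m _]mulmxA mulVmx// mulmx1 addrK.
by rewrite /invmx Gu -scalemxAr mxtraceZ mulrC.
Qed.

End AlongPath.
End GramOperator.

(** * Singular values *)

Section SingularValues.
Variables (R : realType) (n : nat).

(** The square root is monotone, so the supremum is attained at the largest eigenvalue. *)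
Lemma sigma_max_ordered (A : 'M[R]_n) m i : ordered_eigenvalues A m ->
  (forall j, m j <= m i) -> sigma_max A = Num.sqrt (m i).
Proof.
move=> om mi.
have ub : ubound (singular_values A) (Num.sqrt (m i)).
  move=> _ [a /(ordered_eigenvalues_eigenvalue a om)[j ->] <-].
  exact: ler_wsqrtr.
have inA : singular_values A (Num.sqrt (m i)).
  by exists (m i) => //; apply/(ordered_eigenvalues_eigenvalue _ om); exists i.
apply/le_anti/andP; split; first by apply: ge_sup => //; exists (Num.sqrt (m i)).
by apply: ub_le_sup => //; exists (Num.sqrt (m i)).
Qed.

Lemma sigma_min_ordered (A : 'M[R]_n) m i : ordered_eigenvalues A m ->
  (forall j, m i <= m j) -> sigma_min A = Num.sqrt (m i).
Proof.
move=> om mi.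
have lb : lbound (singular_values A) (Num.sqrt (m i)).
  move=> _ [a /(ordered_eigenvalues_eigenvalue a om)[j ->] <-].
  exact: ler_wsqrtr.
have inA : singular_values A (Num.sqrt (m i)).
  by exists (m i) => //; apply/(ordered_eigenvalues_eigenvalue _ om); exists i.
apply/le_anti/andP; split; first by apply: ge_inf => //; exists (Num.sqrt (m i)).
by apply: lb_le_inf => //; exists (Num.sqrt (m i)).
Qed.

End SingularValues.

Lemma inner_product_unit_eigenvector (R : realType) n
    (b : 'rV[R]_n -> 'rV[R]_n -> R) (A : 'M[R]_n) a :
  inner_product b -> eigenvalue A a -> exists2 u, u *m A = a *: u & b u u = 1.
Proof.
move=> ib /eigenvalueP[v vA v0].
have vv := inner_product_pos ib v0.
exists ((Num.sqrt (b v v))^-1 *: v); first by rewrite -scalemxAl vA !scalerA mulrC.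
rewrite (inner_productZ ib) (inner_product_sym ib) (inner_productZ ib) mulrA -invfM.
by rewrite -expr2 sqr_sqrtr ?ltW// mulVf// gt_eqF.
Qed.

Theorem proposition6p3 (R : realType) (n k : nat) (S : manifold R n)
  (Z : bundle_data S k) (hZ : forall p : S, fibre Z p -> fibre Z p -> R)
  (F : forall p : S, tangent p -> fibre Z p)
  (g : forall p : S, tangent p -> tangent p -> R)
  (nabla : connection_op S) (G : S -> 'M[R]_n)
  (J : set R) (p : R -> S)
  (D : field_along p -> field_along p) (DG : R -> 'M[R]_n) :
  is_vector_bundle Z ->
  is_fibre_metric hZ ->
  is_tangent_morphism F ->
  is_riemannian_metric g ->
  is_levi_civita g nabla ->
  is_gram_operator g (response_metric hZ F) G ->
  open J -> is_interval J -> smooth_path J p ->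
  is_covariant_derivative_along nabla J D ->
  is_covariant_derivative_end J D (G \o p) DG ->
  [/\
   (* (a) *)
   forall (mu : R -> 'I_n -> R),
     (forall t, J t -> ordered_eigenvalues (G (p t)) (mu t)) ->
     forall (i : 'I_n) (t : R) (u : tangent (p t)),
       J t -> 0 < mu t i -> simple_eigenvalue (G (p t)) (mu t i) ->
       u *m G (p t) = mu t i *: u -> g (p t) u u = 1 ->
       is_derive t 1 (fun s => mu s i) (g (p t) (u *m DG t) u) /\
       is_derive t 1 (fun s => Num.sqrt (mu s i))
         ((2 * Num.sqrt (mu t i))^-1 * g (p t) (u *m DG t) u),
   (* (b) *)
   (0 < n)%N -> (forall t, J t -> complete_locus F (p t)) ->
     forall t, J t ->
       is_derive t 1 (fun s => ln (\det (G (p s))))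
         (\tr (DG t *m invmx (G (p t))))
   & (* (c) *)
   (0 < n)%N -> (forall t, J t -> complete_locus F (p t)) ->
     (forall t, J t ->
        simple_singular_value (G (p t)) (sigma_max (G (p t))) /\
        simple_singular_value (G (p t)) (sigma_min (G (p t)))) ->
     forall t, J t ->
       [/\ derivable (fun s => sigma_max (G (p s))) t 1,
           derivable (fun s => sigma_min (G (p s))) t 1
         & is_derive t 1 (fun s => ln (condition_number (G (p s))))
             ('D_1 (fun s => sigma_max (G (p s))) t / sigma_max (G (p t)) -
              'D_1 (fun s => sigma_min (G (p s))) t / sigma_min (G (p t)))]].
Proof.
move=> _ hZm Fm gm _ Gg oJ _ sp cD cDG.
have part_a (mu : R -> 'I_n -> R)
    (omu : forall t, J t -> ordered_eigenvalues (G (p t)) (mu t))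
    (i : 'I_n) (t : R) (u : tangent (p t)) : J t -> 0 < mu t i ->
    simple_eigenvalue (G (p t)) (mu t i) ->
    u *m G (p t) = mu t i *: u -> g (p t) u u = 1 ->
    is_derive t 1 (fun s => mu s i) (g (p t) (u *m DG t) u) /\
    is_derive t 1 (fun s => Num.sqrt (mu s i))
      ((2 * Num.sqrt (mu t i))^-1 * g (p t) (u *m DG t) u).
  move=> Jt mu0 simple uG uu.
  have d := is_derive_gram_eigenvalue hZm Fm gm Gg oJ sp cD cDG Jt omu simple uG uu.
  split=> //.
  by apply: is_derive_eq (is_derive1_comp (is_derive1_sqrt mu0) d) _; rewrite mulrC.
split=> //.
  move=> _ Fp t Jt.
  exact: (is_derive_ln_det_gram hZm Fm gm Gg oJ sp cD cDG Jt (Fp t Jt)).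
move=> n0 Fp simple t Jt.
(* Part (c) names no eigenvalue functions; self-adjointness provides an ordered list at every time,
   to which (a) applies. *)
have [mu omu] := choice (fun s => gram_ordered_eigenvalues hZm gm Gg (p s)).
have {}part_a := part_a mu (fun s _ => omu s).
(* The order is nonincreasing: the largest eigenvalue has index 0 and the smallest [n.-1]. *)
pose i0 := Ordinal n0; have n1 : (n.-1 < n)%N by rewrite prednK.
pose i1 := Ordinal n1.
have mu0 s j : J s -> 0 < mu s j.
  move=> Js; apply: (gram_eigenvalue_gt0 hZm gm Gg (Fp s Js)).
  by apply/(ordered_eigenvalues_eigenvalue _ (omu s)); exists j.
have maxE s : sigma_max (G (p s)) = Num.sqrt (mu s i0).
  by apply: sigma_max_ordered (omu s) _ => j; have [+ _] := omu s; exact.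
have minE s : sigma_min (G (p s)) = Num.sqrt (mu s i1).
  apply: sigma_min_ordered (omu s) _ => j; have [+ _] := omu s; apply.
  by rewrite /= -ltnS prednK.
(* The unit eigenvector required by (a) is obtained by normalizing any eigenvector. *)
have derivable_sqrt i : simple_eigenvalue (G (p t)) (mu t i) ->
    derivable (fun s => Num.sqrt (mu s i)) t 1.
  move=> si; have [|u uG uu] := inner_product_unit_eigenvector (A := G (p t))
    (a := mu t i) (metric_inner gm (p t)).
    by apply/(ordered_eigenvalues_eigenvalue _ (omu t)); exists i.
  by have [_ []] := part_a i t u Jt (mu0 t i Jt) si uG uu.
have [[_ smax] [_ smin]] := simple t Jt.
have dmax : derivable (fun s => sigma_max (G (p s))) t 1.
  under eq_fun do rewrite maxE; apply: derivable_sqrt.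
  (* Simplicity is assumed at the square of the singular value, which is the eigenvalue by
     positivity. *)
  by rewrite -(sqr_sqrtr (ltW (mu0 t i0 Jt))) -maxE.
have dmin : derivable (fun s => sigma_min (G (p s))) t 1.
  under eq_fun do rewrite minE; apply: derivable_sqrt.
  by rewrite -(sqr_sqrtr (ltW (mu0 t i1 Jt))) -minE.
have max0 s : J s -> 0 < sigma_max (G (p s)) by move=> Js; rewrite maxE sqrtr_gt0 mu0.
have min0 s : J s -> 0 < sigma_min (G (p s)) by move=> Js; rewrite minE sqrtr_gt0 mu0.
split=> //.
have lmax := is_derive1_comp (is_derive1_ln (max0 t Jt)) (derivableP dmax).
have lmin := is_derive1_comp (g := fun s => sigma_min (G (p s)))
  (is_derive1_ln (min0 t Jt)) (derivableP dmin).
have /is_derive_eq lB := is_deriveB lmax lmin.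
(* The logarithm of the quotient splits where both singular values are positive, hence on the
   neighbourhood [J] of [t]. *)
apply: near_eq_is_derive (lB _ _).
  have := open_nbhs_nbhs (conj oJ Jt); apply: filterS => s Js.
  by rewrite /condition_number ln_div// posrE ?max0 ?min0.
by rewrite ![_ / sigma_max _]mulrC ![_ / sigma_min _]mulrC.
Qed.
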